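(* If $X$ is a separable Banach function space on the unit circle $\mathbb{T}$, then the set of analytic polynomials $\mathcal{P}_A$ is dense (with respect to the norm of $X$) in the abstract Hardy space $$H[X]=\{f\in X:\ \widehat{f}(n)=0\ \text{for all}\ n<0\}$$ built upon the space $X$.
   Context: $\mathbb{T}=\{z\in\mathbb{C}:|z|=1\}$ is the unit circle with normalized Lebesgue measure $dm(t)=|dt|/(2\pi)$; $L^1=L^1(\mathbb{T})$. $L^0$ is the space of measurable complex-valued functions on $\mathbb{T}$ (functions equal a.e. are identified), and $L^0_+$ is the set of measurable functions on $\mathbb{T}$ with values in $[0,\infty]$. Banach function space: a mapping $\rho:L^0_+\to[0,\infty]$ is a Banach function norm if for all $f,g,f_n\in L^0_+$ ($n\in\mathbb{N}$), all constants $a\ge 0$ and all measurable $E\subset\mathbb{T}$: (A1) $\rho(f)=0\Leftrightarrow f=0$ a.e., $\rho(af)=a\rho(f)$, $\rho(f+g)\le\rho(f)+\rho(g)$; (A2) $0\le g\le f$ a.e. implies $\rho(g)\le\rho(f)$; (A3) $0\le f_n\uparrow f$ a.e. implies $\rho(f_n)\uparrow\rho(f)$; (A4) $m(E)<\infty$ implies $\rho(\chi_E)<\infty$; (A5) $\int_E f\,dm\le C_E\,\rho(f)$ with a constant $C_E\in(0,\infty)$ that may depend on $E$ and $\rho$ but not on $f$. The set $X=\{f\in L^0:\rho(|f|)<\infty\}$ with norm $\|f\|_X=\rho(|f|)$ is called a Banach function space; it is a Banach space continuously embedded in $L^1$. ''Separable'' means separable as a normed space. Fourier coefficients of $f\in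 L^1$: $\widehat{f}(n)=\frac{1}{2\pi}\int_{-\pi}^{\pi}f(e^{i\theta})e^{-in\theta}\,d\theta$, $n\in\mathbb{Z}$. An analytic polynomial is a function on $\mathbb{T}$ of the form $q(t)=\sum_{k=0}^n\alpha_k t^k$ with $\alpha_0,\dots,\alpha_n\in\mathbb{C}$; $\mathcal{P}_A$ is the set of all analytic polynomials. *)

(* Defs.v *)
From HB Require Import structures.
From mathcomp Require Import all_boot all_order all_algebra.
From mathcomp Require Import complex.
From mathcomp Require Import all_classical all_reals all_analysis.
From mathcomp Require Import measurable_realfun.
Import Order.TTheory GRing.Theory Num.Theory.
Import numFieldNormedType.Exports.

Set Implicit Arguments.
Unset Strict Implicit.
Unset Printing Implicit Defensive.

Local Open Scope classical_set_scope.
Local Open Scope ring_scope.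
Local Open Scope complex_scope.

Definition circle (R : realType) : Type := {z : R[i] | `|z| == 1}.

HB.instance Definition _ (R : realType) := SubType.on (circle R).
HB.instance Definition _ (R : realType) := Choice.on (circle R).

Section circle_sigma_algebra.
Variable R : realType.

Fact circle_one_subproof : `|1 : R[i]| == 1.
Proof. by rewrite normr1. Qed.

HB.instance Definition _ :=
  isPointed.Build (circle R) (exist _ (1 : R[i]) circle_one_subproof).

Definition circle_coord (t : circle R) : R * R :=
  (complex.Re (\val t), complex.Im (\val t)).

(* The Borel sigma-algebra of the circle as a subspace of the plane.  Every
   Lebesgue measurable function is a.e. equal to a Borel one, so nothing is
   lost for spaces of functions taken modulo a.e. equality. *)
Definition circle_measurable : set (set (circle R)) :=
  preimage_set_system setT circle_coord measurable.

Let circle_sigma_algebra : sigma_algebra setT circle_measurable.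
Proof. exact/sigma_algebra_preimage/sigma_algebra_measurable. Qed.

Let circle_measurable0 : circle_measurable set0.
Proof. by have [] := circle_sigma_algebra. Qed.

Let circle_measurableC A : circle_measurable A -> circle_measurable (~` A).
Proof. by have [_ + _] := circle_sigma_algebra => /[apply]; rewrite setTD. Qed.

Let circle_measurable_bigcup (F : (set (circle R))^nat) :
  (forall i, circle_measurable (F i)) -> circle_measurable (\bigcup_i F i).
Proof. by have [_ _] := circle_sigma_algebra; apply. Qed.

HB.instance Definition _ := @isMeasurable.Build default_measure_display
  (circle R) circle_measurable
  circle_measurable0 circle_measurableC circle_measurable_bigcup.

End circle_sigma_algebra.

Section circle_measure.
Variable R : realType.

Definition expi (x : R) : R[i] := cos x +i* sin x.

Lemma norm_expi (x : R) : `|expi x| == 1.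
Proof. by rewrite normc_def /= cos2Dsin2 sqrtr1. Qed.

Definition cis (x : measurableTypeR R) : circle R :=
  exist _ (expi x) (norm_expi x).

Lemma measurable_cis : measurable_fun setT cis.
Proof.
move=> _ _ [B mB <-]; rewrite !setTI.
rewrite (_ : _ @^-1` _ = (fun x : R => (cos x, sin x)) @^-1` B)//.
rewrite -[X in measurable X]setTI.
apply: (@measurable_fun_pair _ _ _ (measurableTypeR R) R R (@cos R) (@sin R)) => //.
- by apply: continuous_measurable_fun; exact: continuous_cos.
- by apply: continuous_measurable_fun; exact: continuous_sin.
Qed.

HB.instance Definition _ := isMeasurableFun.Build _ _ _ _ cis measurable_cis.

Fact measurable_pi_itv : measurable (`[- pi, pi]%classic : set (measurableTypeR R)).
Proof. exact: measurable_itv. Qed.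

Fact two_pi_inv_ge0 : 0 <= (2 * pi : R)^-1.
Proof. by rewrite invr_ge0 mulr_ge0// pi_ge0. Qed.

(* Normalized Lebesgue (arc length) measure: the image under x |-> e^{ix} of
   dx / (2 pi) on [-pi, pi]. *)
Definition circle_measure : set (circle R) -> \bar R :=
  pushforward
    (mscale (NngNum two_pi_inv_ge0) (mrestr lebesgue_measure measurable_pi_itv))
    cis.

Let circle_measure0 : circle_measure set0 = 0%E.
Proof. exact: measure0. Qed.

Let circle_measure_ge0 A : (0 <= circle_measure A)%E.
Proof. exact: measure_ge0. Qed.

Let circle_measure_sigma_additive : semi_sigma_additive circle_measure.
Proof. exact: measure_semi_sigma_additive. Qed.

HB.instance Definition _ := isMeasure.Build _ _ _ circle_measure
  circle_measure0 circle_measure_ge0 circle_measure_sigma_additive.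

Lemma circle_measureT : circle_measure [set: circle R] = 1%E.
Proof.
rewrite /circle_measure /pushforward preimage_setT /mscale/= /mrestr setTI.
have pi2 : 0 < pi + pi :> R by rewrite addr_gt0// pi_gt0.
rewrite lebesgue_measure_itv/= lte_fin ifT; last first.
  by rewrite -subr_gt0 opprK.
rewrite opprK -EFinM; congr EFin.
by rewrite /= -[pi + pi]mulr2n -[pi *+ 2]mulr_natl mulVf// mulr_natl mulr2n
  gt_eqF.
Qed.

HB.instance Definition _ :=
  Measure_isProbability.Build _ _ R circle_measure circle_measureT.

End circle_measure.

Section banach_function_space.
Local Open Scope ereal_scope.
Context {R : realType}.
Implicit Types (rho : (circle R -> \bar R) -> \bar R).

Local Notation m := (@circle_measure R).

Definition L0 : set (circle R -> R[i]) :=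
  [set f | measurable_fun setT (fun t => complex.Re (f t)) /\
           measurable_fun setT (fun t => complex.Im (f t))].

Definition L0p : set (circle R -> \bar R) :=
  [set f | measurable_fun setT f /\ forall t, 0 <= f t].

(* A mapping L0p -> [0, +oo] is encoded as a total function rho on
   circle R -> \bar R; its values outside L0p are unconstrained and never
   used. *)
Record banach_function_norm rho : Prop := {
  bfn_ge0 : forall f, L0p f -> 0 <= rho f ;
  bfn_eq0 : forall f, L0p f ->
    rho f = 0 <-> {ae m, forall t, f t = 0} ;
  bfn_scale : forall (a : R) f, (0 <= a)%R -> L0p f ->
    rho (fun t => a%:E * f t) = a%:E * rho f ;
  bfn_triangle : forall f g, L0p f -> L0p g ->
    rho (fun t => f t + g t) <= rho f + rho g ;
  bfn_le : forall f g, L0p f -> L0p g ->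
    {ae m, forall t, g t <= f t} -> rho g <= rho f ;
  bfn_fatou : forall (f_ : (circle R -> \bar R)^nat) f,
    (forall n, L0p (f_ n)) -> L0p f ->
    {ae m, forall t, nondecreasing_seq (fun n => f_ n t) /\
                     f_ n t @[n --> \oo] --> f t} ->
    nondecreasing_seq (fun n => rho (f_ n)) /\
    rho (f_ n) @[n --> \oo] --> rho f ;
  bfn_indic : forall E, measurable E -> m E < +oo ->
    rho (fun t => (\1_E t)%:E) < +oo ;
  bfn_L1 : forall E, measurable E -> exists C : R, (0 < C)%R /\
    forall f, L0p f -> \int[m]_(t in E) f t <= C%:E * rho f }.

Definition bfs_norm rho (f : circle R -> R[i]) : \bar R :=
  rho (fun t => (Normc.normc (f t))%:E).

Definition bfs rho : set (circle R -> R[i]) :=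
  [set f | L0 f /\ bfs_norm rho f < +oo].

(* Functions equal a.e. are at distance 0, so working with representatives
   instead of classes does not affect the two notions below. *)
Definition bfs_dense rho (A B : set (circle R -> R[i])) : Prop :=
  A `<=` B /\
  forall f, B f -> forall e : R, (0 < e)%R ->
    exists2 g, A g & bfs_norm rho (fun t => f t - g t)%R < e%:E.

Definition bfs_separable rho : Prop :=
  exists2 D : set (circle R -> R[i]), countable D & bfs_dense rho D (bfs rho).

End banach_function_space.

Section hardy.
Context {R : realType}.

Definition cintegral (A : set R) (h : R -> R[i]) : R[i] :=
  (\int[lebesgue_measure]_(x in A) complex.Re (h x)) +i*
  (\int[lebesgue_measure]_(x in A) complex.Im (h x)).

Definition fourier_coef (f : circle R -> R[i]) (n : int) : R[i] :=
  ((2 * pi)^-1 : R)%:C *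
  cintegral `[- pi, pi]%classic (fun x => f (cis x) * expi (- (n%:~R * x))).

Definition abstract_hardy (rho : (circle R -> \bar R) -> \bar R) :
    set (circle R -> R[i]) :=
  [set f | bfs rho f /\ forall n : int, n < 0 -> fourier_coef f n = 0].

Definition analytic_polynomials : set (circle R -> R[i]) :=
  [set q | exists p : {poly R[i]}, q = fun t => p.[\val t]].

End hardy.

(* Main.v *)
Require Import Defs.
From HB Require Import structures.
From mathcomp Require Import all_boot all_order all_algebra.
From mathcomp Require Import complex ring lra.
From mathcomp Require Import all_classical all_reals all_analysis.
From mathcomp Require Import measurable_realfun.
Import Order.TTheory GRing.Theory Num.Theory.
Import numFieldNormedType.Exports.

(** Analytic polynomials are dense in H[X] for two reasons.

    First, the norm of a separable space X is absolutely continuous: for g >= 0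
    in X, the norm of g 1_E is small as soon as m(E) is small
    ([rnorm_absolutely_continuous]).  Otherwise the Fatou property yields
    disjoint sets F_j with ||g 1_{F_j}|| bounded below; a diagonal choice of a
    set S of indices then makes g 1_{U_{j in S} F_j} stay away from every
    function of a countable set ([no_disjoint_lower_bound]).

    Secondly, let f be in H[X], write s_N for the N-th Fejer mean and let F_N
    be the analytic polynomial with Re F_N = s_N |f| on the circle and
    F_N(0) = ||f||_1 ([fejer_poly]).  As the negative Fourier coefficients of f
    vanish, s_N f is an analytic polynomial too ([fejer_mean_analytic]), and
    |s_N f| <= s_N |f| ([fejer_mean_complex_le]).  The approximants are
    O * s_N f, where O = (1 - F_N/(nM))^M with M huge is a polynomial that
    behaves like exp(- F_N/n) ([exp_like_poly]).  Since
    |O| is at most about exp(- s_N |f| / n), both |O| and |O * s_N f| are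
    bounded by constants that depend only on n ([multiplier_bounds]).  Since
    O(0) is at least 1 - ||f||_1 / n, the mean square of O - 1 is at most
    (1 + 2 ||f||_1) / n.

    Finally |O s_N f - f| <= |O| |s_N f - f| + |f| |O - 1|.  Off the sets
    E1 = {|s_N f - f| >= eps} and E2 = {|O - 1| >= eps} this is at most
    2 eps (1 + |f|); on E1 the first term is at most 2n (1 + |f|), and on E2 the
    second is at most 3 (1 + |f|) ([normc_split]).  By Chebyshev's inequality
    E2 is small once n is large; with n fixed, E1 is small once N is large,
    since s_N f tends to f in L^1 ([fejer_cvg_L1]).  Absolute continuity
    applied to 1 + |f| concludes ([hardy_approx]). *)

Set Implicit Arguments.
Unset Strict Implicit.
Unset Printing Implicit Defensive.
Local Open Scope classical_set_scope.
Local Open Scope ring_scope.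
Local Open Scope complex_scope.

(** * Averages over a period *)

Section mean.
Context {R : realType}.
Local Notation mu := (@lebesgue_measure R).
Local Notation I := (`[- pi, pi]%classic : set R).
Implicit Types (f g h : R -> R).

Lemma pi2_gt0 : 0 < 2 * pi :> R.
Proof. by rewrite mulr_gt0 ?pi_gt0. Qed.

Lemma measurable_period : measurable (I : set (measurableTypeR R)).
Proof. exact: measurable_itv. Qed.
Local Notation mI := measurable_period.

Lemma measure_period : mu I = (2 * pi)%:E.
Proof.
rewrite lebesgue_measure_itv/= lte_fin ifT; last first.
  by have := pi_gt0 R; lra.
by rewrite -EFinD; congr EFin; ring.
Qed.

(** Lebesgue integrability on [-pi, pi]. *)
Definition summable_period h := mu.-integrable I (EFin \o h).
Local Notation itg := summable_period.

(** The average of h over [-pi, pi]: integration against the normalized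
    measure of the circle, read in the variable x of e^{ix}. *)
Definition mean h : R := (2 * pi)^-1 * \int[mu]_(x in I) h x.

Lemma itgD f g : itg f -> itg g -> itg (fun x => f x + g x).
Proof. by move=> hf hg; exact: (integrableD mI hf hg). Qed.

Lemma itgB f g : itg f -> itg g -> itg (fun x => f x - g x).
Proof. by move=> hf hg; exact: (integrableB mI hf hg). Qed.

Lemma itgZ a f : itg f -> itg (fun x => a * f x).
Proof. by move=> hf; exact: (integrableZl mI a hf). Qed.

Lemma eq_itg f g : (forall x, I x -> f x = g x) -> itg f -> itg g.
Proof.
move=> fg; apply: (@eq_integrable _ _ R mu I mI).
by move=> x; rewrite inE => /fg /= ->.
Qed.

Lemma itgN f : itg f -> itg (fun x => - f x).
Proof. by move=> /(itgZ (-1)); apply: eq_itg => x _; rewrite mulN1r. Qed.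

Lemma itg_abs f : itg f -> itg (fun x => `|f x|).
Proof. exact: integrable_norm. Qed.

Lemma continuous_itg f : continuous f -> itg f.
Proof.
move=> cf; apply: (@continuous_compact_integrable R f).
  exact: segment_compact.
exact: continuous_subspaceT.
Qed.

Lemma itgM_continuous f g : continuous g -> itg f -> itg (fun x => g x * f x).
Proof.
move=> cg hf; have mg : measurable_fun I g.
  by apply: measurable_funTS; exact: continuous_measurable_fun.
have bg : [bounded g x | x in I].
  have cptI : compact I by exact: segment_compact.
  have /compact_bounded[M [_ mrt]] :=
    continuous_compact (continuous_subspaceT cg) cptI.
  by exists M; split; rewrite ?num_real // => ? ? ? ?; exact: mrt.
have := integrableMr mI mg bg hf.
by rewrite /summable_period; congr integrable.
Qed.

Lemma itg_le f g : measurable_fun (I : set (measurableTypeR R)) f ->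
  (forall x, I x -> `|f x| <= g x) -> itg g -> itg f.
Proof.
move=> mf fg hg; apply: (@le_integrable _ _ R mu I mI (EFin \o f) (EFin \o g)) => //.
  exact/measurable_EFinP.
move=> x Ix; rewrite /= lee_fin (le_trans (fg x Ix))//; exact: ler_norm.
Qed.

Lemma eq_mean f g : (forall x, I x -> f x = g x) -> mean f = mean g.
Proof.
move=> fg; rewrite /mean; congr (_ * _); apply: eq_Rintegral => x.
by rewrite inE => /fg.
Qed.

Lemma meanD f g : itg f -> itg g ->
  mean (fun x => f x + g x) = mean f + mean g.
Proof. by move=> hf hg; rewrite /mean RintegralD// ?mulrDr//; exact: mI. Qed.

Lemma meanB f g : itg f -> itg g ->
  mean (fun x => f x - g x) = mean f - mean g.
Proof. by move=> hf hg; rewrite /mean RintegralB// ?mulrBr//; exact: mI. Qed.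

Lemma meanZ a f : itg f -> mean (fun x => a * f x) = a * mean f.
Proof. by move=> hf; rewrite /mean RintegralZl// 1?mulrCA//; exact: mI. Qed.

Lemma meanN f : itg f -> mean (fun x => - f x) = - mean f.
Proof.
move=> hf; rewrite -mulN1r -meanZ//; apply: eq_mean => x _; by rewrite mulN1r.
Qed.

Lemma mean_cst a : mean (fun=> a) = a.
Proof.
rewrite /mean Rintegral_cst; last exact: mI.
rewrite [X in fine X](_ : _ = (2 * pi)%:E); last exact: measure_period.
rewrite /=.
by rewrite mulrCA mulVf ?mulr1// gt_eqF// pi2_gt0.
Qed.

Lemma itg_cst a : itg (fun=> a).
Proof. by apply: continuous_itg => x; exact: cvg_cst. Qed.

Lemma le_mean f g : itg f -> itg g -> (forall x, I x -> f x <= g x) ->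
  mean f <= mean g.
Proof.
move=> hf hg fg; rewrite /mean ler_pM2l ?invr_gt0 ?pi2_gt0//.
by apply: le_Rintegral => //; exact: mI.
Qed.

Lemma mean_ge0 f : (forall x, I x -> 0 <= f x) -> 0 <= mean f.
Proof.
move=> f0; rewrite /mean mulr_ge0 ?invr_ge0 ?(ltW pi2_gt0)//.
exact: Rintegral_ge0.
Qed.

Lemma itg_sum (J : Type) (s : seq J) (F : J -> R -> R) :
  (forall j, itg (F j)) -> itg (fun x => \sum_(j <- s) F j x).
Proof.
move=> hF; elim: s => [|j s IH].
  by apply: eq_itg (itg_cst 0) => x _; rewrite big_nil.
by apply: eq_itg (itgD (hF j) IH) => x _; rewrite big_cons.
Qed.

Lemma mean_sum (J : Type) (s : seq J) (F : J -> R -> R) :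
  (forall j, itg (F j)) ->
  mean (fun x => \sum_(j <- s) F j x) = \sum_(j <- s) mean (F j).
Proof.
move=> hF; elim: s => [|j s IH].
  rewrite big_nil -[RHS](mean_cst 0); apply: eq_mean => x _; by rewrite big_nil.
rewrite big_cons -IH -meanD//; last exact: itg_sum.
by apply: eq_mean => x _; rewrite big_cons.
Qed.

Lemma ler_norm_mean f : itg f -> `|mean f| <= mean (fun x => `|f x|).
Proof.
move=> hf; rewrite ler_norml; apply/andP; split.
  rewrite -meanN; last exact: itg_abs.
  apply: le_mean => //; first exact/itgN/itg_abs.
  by move=> x _; rewrite lerNl -normrN ler_norm.
by apply: le_mean => //; [exact: itg_abs | move=> x _; exact: ler_norm].
Qed.

Lemma continuous_cosM (k y : R) : continuous (fun x => cos (k * x + y)).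
Proof.
move=> x; apply: (@continuous_comp _ _ _ (fun x => k * x + y) (@cos R)).
  by apply: cvgD; [apply: cvgM; [exact: cvg_cst|exact: cvg_id] | exact: cvg_cst].
exact: continuous_cos.
Qed.

Lemma continuous_sinM (k y : R) : continuous (fun x => sin (k * x + y)).
Proof.
move=> x; apply: (@continuous_comp _ _ _ (fun x => k * x + y) (@sin R)).
  by apply: cvgD; [apply: cvgM; [exact: cvg_cst|exact: cvg_id] | exact: cvg_cst].
exact: continuous_sin.
Qed.

Lemma mean_derive (f F : R -> R) : continuous f ->
  (forall x, is_derive x (1 : R) F (f x)) ->
  mean f = (2 * pi)^-1 * (F pi - F (- pi)).
Proof.
move=> cf dF; rewrite /mean /Rintegral (@continuous_FTC2 _ f F)//.
- by have := pi_gt0 R; lra.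
- exact: continuous_subspaceT.
- have cF : continuous F.
    move=> x; apply: differentiable_continuous; apply/derivable1_diffP.
    by have [] := dF x.
  split.
  + by move=> x _; have [] := dF x.
  + by apply: cvg_at_right_filter; exact: cF.
  + by apply: cvg_at_left_filter; exact: cF.
- by move=> x _; rewrite derive1E; have [_ ->] := dF x.
Qed.

Lemma sin_natpi (n : nat) : sin (n%:R * pi) = 0 :> R.
Proof.
elim: n => [|n IH]; first by rewrite mul0r sin0.
by rewrite -natr1 mulrDl mul1r sinDpi IH oppr0.
Qed.

Lemma mean_cos (k : nat) : (0 < k)%N -> mean (fun x => cos (k%:R * x)) = 0.
Proof.
move=> k0; have kn0 : k%:R != 0 :> R by rewrite pnatr_eq0 -lt0n.
have dF x : is_derive x (1 : R) (fun x => k%:R^-1 * sin (k%:R * x))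
    (cos (k%:R * x)).
  apply: is_derive_eq.
  by rewrite /GRing.scale/= mulr1 mulrA mulrC; field.
rewrite (mean_derive _ dF).
- by rewrite mulrN sinN sin_natpi oppr0 mulr0 subrr mulr0.
- move=> x; have := @continuous_cosM k%:R 0 x.
  by under [X in continuous_at _ X -> _]eq_fun do rewrite addr0.
Qed.

Lemma mean_sin (k : nat) : mean (fun x => sin (k%:R * x)) = 0.
Proof.
case: k => [|k].
  by rewrite -[RHS](mean_cst 0); apply: eq_mean => x _; rewrite mul0r sin0.
have kn0 : k.+1%:R != 0 :> R by rewrite pnatr_eq0.
have dF x : is_derive x (1 : R) (fun x => - k.+1%:R^-1 * cos (k.+1%:R * x))
    (sin (k.+1%:R * x)).
  apply: is_derive_eq.
  by rewrite /GRing.scale/= mulr1; field.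
rewrite (mean_derive _ dF).
- by rewrite mulrN cosN subrr mulr0.
- move=> x; have := @continuous_sinM k.+1%:R 0 x.
  by under [X in continuous_at _ X -> _]eq_fun do rewrite addr0.
Qed.

End mean.

(** * Complex numbers and the circle *)

Section complex_facts.
Context {R : realType}.
Implicit Types (z w : R[i]) (x y u : R).
Local Notation Re := (@complex.Re R).
Local Notation Im := (@complex.Im R).
Local Notation normc := (@Normc.normc R).

Lemma Re_add z w : Re (z + w) = Re z + Re w. Proof. by case: z; case: w. Qed.
Lemma Im_add z w : Im (z + w) = Im z + Im w. Proof. by case: z; case: w. Qed.
Lemma Re_opp z : Re (- z) = - Re z. Proof. by case: z. Qed.
Lemma Im_opp z : Im (- z) = - Im z. Proof. by case: z. Qed.
Lemma Re_mul z w : Re (z * w) = Re z * Re w - Im z * Im w.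
Proof. by case: z; case: w. Qed.
Lemma Im_mul z w : Im (z * w) = Re z * Im w + Im z * Re w.
Proof. by case: z; case: w. Qed.

Lemma Re_sum (J : Type) (s : seq J) (F : J -> R[i]) :
  Re (\sum_(j <- s) F j) = \sum_(j <- s) Re (F j).
Proof. by apply: (big_morph Re Re_add). Qed.

Lemma Im_sum (J : Type) (s : seq J) (F : J -> R[i]) :
  Im (\sum_(j <- s) F j) = \sum_(j <- s) Im (F j).
Proof. by apply: (big_morph Im Im_add). Qed.

Lemma complex_eqP z w : Re z = Re w -> Im z = Im w -> z = w.
Proof. by case: z => a b; case: w => c d /= -> ->. Qed.

Lemma normc_ge0 z : 0 <= normc z.
Proof. by case: z => a b; rewrite /= sqrtr_ge0. Qed.

Lemma sqr_normc_ReIm z : normc z ^+ 2 = Re z ^+ 2 + Im z ^+ 2.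
Proof. by case: z => a b; rewrite /= sqr_sqrtr// addr_ge0 ?sqr_ge0. Qed.

Lemma Re_le_normc z : `|Re z| <= normc z.
Proof.
rewrite -(@ler_pXn2r _ 2)// ?nnegrE ?normc_ge0//.
by rewrite real_normK ?num_real// sqr_normc_ReIm lerDl sqr_ge0.
Qed.

Lemma Im_le_normc z : `|Im z| <= normc z.
Proof.
rewrite -(@ler_pXn2r _ 2)// ?nnegrE ?normc_ge0//.
by rewrite real_normK ?num_real// sqr_normc_ReIm lerDr sqr_ge0.
Qed.

Lemma normc_le z : normc z <= `|Re z| + `|Im z|.
Proof.
rewrite -(@ler_pXn2r _ 2)// ?nnegrE ?normc_ge0 ?addr_ge0//.
rewrite sqr_normc_ReIm sqrrD !real_normK ?num_real//.
by rewrite addrAC lerDl mulrn_wge0// mulr_ge0.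
Qed.

Lemma normc_expi u : normc (expi u) = 1.
Proof. by rewrite /= cos2Dsin2 sqrtr1. Qed.

Lemma expiX u n : expi u ^+ n = expi (n%:R * u).
Proof.
elim: n => [|n IH]; first by rewrite expr0 /expi mul0r cos0 sin0.
rewrite exprS IH -natr1 mulrDl mul1r; apply: complex_eqP.
  by rewrite Re_mul /= [_ + u]addrC cosD.
by rewrite Im_mul /= [_ + u]addrC sinD addrC.
Qed.

Lemma cis_surj (t : circle R) : exists x, t = cis x.
Proof.
case: t => -[a b] abE.
have ab1 : a ^+ 2 + b ^+ 2 = 1.
  move: (abE); rewrite normc_def /= => /eqP[] /(congr1 (fun r => r ^+ 2)).
  by rewrite sqr_sqrtr ?addr_ge0 ?sqr_ge0// expr1n.
have a1 : -1 <= a <= 1.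
  rewrite -ler_norml -(@ler_pXn2r _ 2)// ?nnegrE// real_normK ?num_real//.
  by rewrite expr1n -ab1 lerDl sqr_ge0.
have bE : Num.sqrt (1 - a ^+ 2) = `|b|.
  by rewrite -ab1 addrAC subrr add0r sqrtr_sqr.
have [b0|b0] := leP 0 b.
  exists (acos a); apply: val_inj; apply: complex_eqP => /=.
    by rewrite acosK// in_itv.
  by rewrite sin_acos// bE ger0_norm.
exists (- acos a); apply: val_inj; apply: complex_eqP => /=.
  by rewrite cosN acosK// in_itv.
by rewrite sinN sin_acos// bE ltr0_norm// opprK.
Qed.

End complex_facts.

(** * Fejer means *)

Section fejer.
Context {R : realType}.
Local Notation mu := (@lebesgue_measure R).
Local Notation I := (`[- pi, pi]%classic : set R).
Local Notation itg := (@summable_period R).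
Local Notation Re := (@complex.Re R).
Local Notation Im := (@complex.Im R).
Local Notation normc := (@Normc.normc R).
Implicit Types (f g h : R -> R) (x y u : R) (j l k N : nat).

(** The Fejer kernel: 1/N times the sum over j, l < N of cos ((j - l) u).  The
    absolute difference of j and l is (j - l) + (l - j) for truncated
    subtraction; keeping it a natural number lets the same index serve as an
    exponent in [fejer_poly]. *)
Definition fejer N u : R :=
  N%:R^-1 * \sum_(j < N) \sum_(l < N) cos ((j - l + (l - j))%:R * u).

Lemma cos_dist j l u : cos ((j - l + (l - j))%:R * u) =
  cos (j%:R * u) * cos (l%:R * u) + sin (j%:R * u) * sin (l%:R * u).
Proof.
rewrite -cosB -mulrBl; have [jl|/ltnW jl] := leqP j l.
  by rewrite (eqP jl) add0n natrB// -cosN -mulNr opprB.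
by rewrite (eqP jl) addn0 natrB.
Qed.

Lemma fejerE N u : fejer N u = N%:R^-1 * normc (\sum_(j < N) expi u ^+ j) ^+ 2.
Proof.
rewrite /fejer sqr_normc_ReIm Re_sum Im_sum; congr (_ * _).
rewrite !expr2 !mulr_suml -big_split; apply: eq_bigr => j _ /=.
rewrite !mulr_sumr -big_split; apply: eq_bigr => l _ /=.
by rewrite !expiX cos_dist.
Qed.

Lemma fejer_ge0 N u : 0 <= fejer N u.
Proof. by rewrite fejerE mulr_ge0 ?invr_ge0 ?sqr_ge0. Qed.

(** Concentration of the kernel: 2 - 2 cos u is |t - 1|^2 for t = e^{iu}, and
    (t - 1) (1 + ... + t^(N-1)) = t^N - 1. *)
Lemma fejer_moment N u : fejer N u * (2 - 2 * cos u) <= 4 / N%:R.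
Proof.
have sq v : normc (expi v - 1) ^+ 2 = 2 - 2 * cos v.
  rewrite sqr_normc_ReIm Re_add Im_add Re_opp Im_opp /=.
  by rewrite subr0 sqrrB1 sin2cos2; ring.
rewrite fejerE -sq -mulrA -exprMn -Normc.normcM mulrC [_ * (_ - 1)]mulrC.
rewrite -subrX1 expiX sq ler_wpM2r ?invr_ge0//.
by have := cos_geN1 (N%:R * u); lra.
Qed.

Lemma continuous_fejer N x : continuous (fun y => fejer N (x - y)).
Proof.
move=> y; apply: cvgM; first exact: cvg_cst.
apply: cvg_big => [|j _]; first exact: add_continuous.
apply: cvg_big => [|l _]; first exact: add_continuous.
set k := (j - l + (l - j))%:R.
suff H : continuous (fun z => cos (k * (x - z))) by exact: H.
rewrite (_ : (fun z => cos (k * (x - z))) = (fun z => cos (- k * z + k * x))).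
  exact: continuous_cosM.
by apply/funext => z; congr cos; ring.
Qed.

(** The Fejer mean of h: the convolution of h with the Fejer kernel. *)
Definition fejer_mean N h x := mean (fun y => fejer N (x - y) * h y).

Lemma itg_fejer N x h : itg h -> itg (fun y => fejer N (x - y) * h y).
Proof. by apply: itgM_continuous; exact: continuous_fejer. Qed.

(** The analytic completion of the Fejer mean of h: a trigonometric sum of
    a_k cos kx + b_k sin kx is the real part of the sum of (a_k - i b_k) e^{ikx}. *)
Definition fejer_poly N h : {poly R[i]} := \sum_(j < N) \sum_(l < N)
  (N%:R^-1 * mean (fun y => cos ((j - l + (l - j))%:R * y) * h y) -i*
   (N%:R^-1 * mean (fun y => sin ((j - l + (l - j))%:R * y) * h y)))
  *: 'X^(j - l + (l - j)).

Lemma itg_cosM k h : itg h -> itg (fun y => cos (k%:R * y) * h y).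
Proof.
apply: itgM_continuous => x; have := @continuous_cosM R k%:R 0 x.
by under [X in continuous_at _ X -> _]eq_fun do rewrite addr0.
Qed.

Lemma itg_sinM k h : itg h -> itg (fun y => sin (k%:R * y) * h y).
Proof.
apply: itgM_continuous => x; have := @continuous_sinM R k%:R 0 x.
by under [X in continuous_at _ X -> _]eq_fun do rewrite addr0.
Qed.

Lemma fejer_meanE N h x : itg h -> fejer_mean N h x =
  \sum_(j < N) \sum_(l < N)
    (N%:R^-1 * mean (fun y => cos ((j - l + (l - j))%:R * y) * h y) *
       cos ((j - l + (l - j))%:R * x) +
     N%:R^-1 * mean (fun y => sin ((j - l + (l - j))%:R * y) * h y) *
       sin ((j - l + (l - j))%:R * x)).
Proof.
move=> hh.
have H k : itg (fun y => N%:R^-1 * (cos (k%:R * x) * (cos (k%:R * y) * h y)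
    + sin (k%:R * x) * (sin (k%:R * y) * h y))).
  by apply/itgZ/itgD; apply: itgZ; [exact: itg_cosM|exact: itg_sinM].
transitivity (mean (fun y => \sum_(j < N) \sum_(l < N)
    N%:R^-1 * (cos ((j - l + (l - j))%:R * x) * (cos ((j - l + (l - j))%:R * y) * h y)
    + sin ((j - l + (l - j))%:R * x) * (sin ((j - l + (l - j))%:R * y) * h y)))).
  apply: eq_mean => y _; rewrite /fejer -mulrA mulr_suml mulr_sumr.
  apply: eq_bigr => j _; rewrite mulr_suml mulr_sumr; apply: eq_bigr => l _.
  by rewrite mulrBr cosB; ring.
rewrite mean_sum => [|j]; last by apply: itg_sum => l.
apply: eq_bigr => j _; rewrite mean_sum //; apply: eq_bigr => l _.
rewrite meanZ; last by apply: itgD; apply: itgZ; [exact: itg_cosM|exact: itg_sinM].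
rewrite meanD ?meanZ; first by ring.
all: try apply: itgZ; first [exact: itg_cosM|exact: itg_sinM].
Qed.

Lemma Re_fejer_poly N h x : itg h ->
  Re (fejer_poly N h).[expi x] = fejer_mean N h x.
Proof.
move=> hh; rewrite fejer_meanE// horner_sum Re_sum; apply: eq_bigr => j _.
rewrite horner_sum Re_sum; apply: eq_bigr => l _.
by rewrite hornerZ hornerXn expiX Re_mul /=; ring.
Qed.

Lemma Re_fejer_poly0 N h : (0 < N)%N -> Re (fejer_poly N h).[0] = mean h.
Proof.
move=> N0; rewrite horner_sum Re_sum.
rewrite (eq_bigr (fun=> N%:R^-1 * mean h)).
  rewrite sumr_const card_ord -mulrnAl -(mulr_natr N%:R^-1) mulVf ?mul1r//.
  by rewrite pnatr_eq0 -lt0n.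
move=> j _; rewrite horner_sum Re_sum (bigD1 j)//= big1 ?addr0.
  rewrite hornerZ hornerXn subnn expr0 Re_mul /= mulr1 mulr0 subr0.
  by congr (_ * _); apply: eq_mean => y _; rewrite addn0 mul0r cos0 mul1r.
move=> l lj; rewrite hornerZ hornerXn expr0n.
case: eqP => [/eqP|_]; last by rewrite mulr0.
rewrite addn_eq0 !subn_eq0 -eqn_leq => /eqP/val_inj jl.
by rewrite jl eqxx in lj.
Qed.

Lemma continuous_poly (p : {poly R[i]}) :
  continuous (fun x => Re p.[expi x]) /\ continuous (fun x => Im p.[expi x]).
Proof.
elim/poly_ind: p => [|p c [IHr IHi]].
  by split=> x; under eq_fun do rewrite horner0 /=; exact: cvg_cst.
split=> x; under eq_fun do rewrite hornerMXaddC ?(Re_add, Im_add) ?(Re_mul, Im_mul) /=.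
  apply: cvgD; last exact: cvg_cst.
  apply: cvgB; apply: cvgM; [exact: IHr | exact: continuous_cos |
    exact: IHi | exact: continuous_sin].
apply: cvgD; last exact: cvg_cst.
apply: cvgD; apply: cvgM; [exact: IHr | exact: continuous_sin |
  exact: IHi | exact: continuous_cos].
Qed.

Lemma itg_Re_poly (p : {poly R[i]}) : itg (fun x => Re p.[expi x]).
Proof. exact/continuous_itg/(continuous_poly p).1. Qed.

Lemma itg_Im_poly (p : {poly R[i]}) : itg (fun x => Im p.[expi x]).
Proof. exact/continuous_itg/(continuous_poly p).2. Qed.

(** Mean value property of polynomials; the factor X^k carries the induction,
    and gives the vanishing of the negative Fourier coefficients. *)
Lemma mean_polyXn (p : {poly R[i]}) k :
  mean (fun x => Re (p * 'X^k).[expi x]) = Re (p * 'X^k).[0] /\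
  mean (fun x => Im (p * 'X^k).[expi x]) = Im (p * 'X^k).[0].
Proof.
elim/poly_ind: p k => [|p c IH] k.
  by split; rewrite mul0r horner0 -[RHS](@mean_cst R); apply: eq_mean => x _;
    rewrite horner0.
have [IHr IHi] := IH k.+1.
have XE : (p * 'X + c%:P) * 'X^k = p * 'X^(k.+1) + c *: 'X^k.
  by rewrite mulrDl -mulrA -exprS mul_polyC.
have cX : mean (fun x => Re (c *: 'X^k).[expi x]) = Re (c *: 'X^k).[0] /\
  mean (fun x => Im (c *: 'X^k).[expi x]) = Im (c *: 'X^k).[0].
  rewrite hornerZ hornerXn; case: k {IH IHr IHi XE} => [|k].
    by split; rewrite expr0 mulr1 -[RHS](@mean_cst R); apply: eq_mean => x _;
      rewrite !hornerE.
  have itc : itg (fun x => cos (k.+1%:R * x)).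
    apply: eq_itg (itg_cosM k.+1 (itg_cst 1)) => x _; by rewrite mulr1.
  have its : itg (fun x => sin (k.+1%:R * x)).
    apply: eq_itg (itg_sinM k.+1 (itg_cst 1)) => x _; by rewrite mulr1.
  rewrite expr0n mulr0 /=; split.
    transitivity (mean (fun x => Re c * cos (k.+1%:R * x) - Im c * sin (k.+1%:R * x))).
      by apply: eq_mean => x _; rewrite hornerZ hornerXn expiX Re_mul.
    rewrite meanB ?meanZ// ?mean_cos// ?mean_sin ?mulr0 ?subrr//; exact: itgZ.
  transitivity (mean (fun x => Re c * sin (k.+1%:R * x) + Im c * cos (k.+1%:R * x))).
    by apply: eq_mean => x _; rewrite hornerZ hornerXn expiX Im_mul.
  rewrite meanD ?meanZ// ?mean_cos// ?mean_sin ?mulr0 ?addr0//; exact: itgZ.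
rewrite XE hornerD Re_add Im_add -IHr -IHi -cX.1 -cX.2 -!meanD.
- by split; apply: eq_mean => x _; rewrite hornerD ?Re_add ?Im_add.
- exact: itg_Im_poly.
- exact: itg_Im_poly.
- exact: itg_Re_poly.
- exact: itg_Re_poly.
Qed.

Lemma mean_Re_poly (p : {poly R[i]}) : mean (fun x => Re p.[expi x]) = Re p.[0].
Proof. by have := (mean_polyXn p 0).1; rewrite expr0 mulr1. Qed.

Lemma fejer_mean1 N x : (0 < N)%N -> fejer_mean N (fun=> 1) x = 1.
Proof.
move=> N0.
have i1 : itg (fun=> 1) by exact: itg_cst.
rewrite fejer_meanE// (eq_bigr (fun=> N%:R^-1)) => [|j _].
  by rewrite sumr_const card_ord -(mulr_natr N%:R^-1) mulVf ?pnatr_eq0 -?lt0n.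
have mc k : mean (fun y => cos (k%:R * y) * 1) = (k == 0%N)%:R.
  transitivity (mean (fun y => cos (k%:R * y))).
    by apply: eq_mean => y _; rewrite mulr1.
  case: k => [|k]; last by rewrite mean_cos.
  by rewrite -[RHS](@mean_cst R); apply: eq_mean => y _; rewrite mul0r cos0.
have ms k : mean (fun y => sin (k%:R * y) * 1) = 0.
  rewrite -[RHS](mean_sin k); by apply: eq_mean => y _; rewrite mulr1.
rewrite (bigD1 j)//= big1 ?addr0.
  by rewrite !mc !ms subnn mul0r cos0 sin0 !mulr1 mulr0 addr0.
move=> l lj; rewrite mc ms mulr0 mul0r addr0.
rewrite addn_eq0 !subn_eq0 -eqn_leq; case: eqP => [/val_inj jl|_].
  by rewrite jl eqxx in lj.
by rewrite mulr0 mul0r.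
Qed.

Lemma le_fejer_mean N f g x : itg f -> itg g -> (forall y, I y -> f y <= g y) ->
  fejer_mean N f x <= fejer_mean N g x.
Proof.
move=> hf hg fg; apply: le_mean; [exact: itg_fejer|exact: itg_fejer|].
by move=> y Iy; apply: ler_wpM2l; [exact: fejer_ge0|exact: fg].
Qed.

Lemma fejer_mean_ge0 N h x : (forall y, 0 <= h y) -> 0 <= fejer_mean N h x.
Proof.
by move=> h0; apply: mean_ge0 => y _; rewrite mulr_ge0 ?fejer_ge0.
Qed.

Lemma fejer_meanB N f g x : itg f -> itg g ->
  fejer_mean N (fun y => f y - g y) x = fejer_mean N f x - fejer_mean N g x.
Proof.
move=> hf hg; rewrite /fejer_mean -meanB; [|exact: itg_fejer..].
by apply: eq_mean => y _; rewrite mulrBr.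
Qed.

Lemma fejer_meanD N f g x : itg f -> itg g ->
  fejer_mean N (fun y => f y + g y) x = fejer_mean N f x + fejer_mean N g x.
Proof.
move=> hf hg; rewrite /fejer_mean -meanD; [|exact: itg_fejer..].
by apply: eq_mean => y _; rewrite mulrDr.
Qed.

Lemma fejer_meanZ N a f x : itg f ->
  fejer_mean N (fun y => a * f y) x = a * fejer_mean N f x.
Proof.
move=> hf; rewrite /fejer_mean -meanZ; last exact: itg_fejer.
by apply: eq_mean => y _; rewrite mulrCA.
Qed.

Lemma ler_norm_fejer_mean N h x : itg h ->
  `|fejer_mean N h x| <= fejer_mean N (fun y => `|h y|) x.
Proof.
move=> hh; apply: le_trans (ler_norm_mean (itg_fejer N x hh)) _.
apply: le_mean; [exact/itg_abs/itg_fejer | exact/itg_fejer/itg_abs |].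
by move=> y _; rewrite normrM ger0_norm// fejer_ge0.
Qed.

Lemma itg_fejer_mean N h : itg h -> itg (fejer_mean N h).
Proof.
move=> hh; apply: eq_itg (itg_Re_poly (fejer_poly N h)) => x _.
exact: Re_fejer_poly.
Qed.

(** Fejer means contract the L^1 norm.  No exchange of integrals is needed:
    the Fejer mean of |h| is the real part of a polynomial whose value at 0 is
    the mean of |h|. *)
Lemma mean_fejer_mean N h : (0 < N)%N -> itg h ->
  mean (fun x => `|fejer_mean N h x|) <= mean (fun x => `|h x|).
Proof.
move=> N0 hh.
rewrite -(Re_fejer_poly0 (fun x => `|h x|) N0) -mean_Re_poly.
apply: le_mean.
- exact/itg_abs/itg_fejer_mean.
- exact: itg_Re_poly.
- move=> x _; rewrite Re_fejer_poly; last exact: itg_abs.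
  exact: ler_norm_fejer_mean.
Qed.

(** For x in the interior of [-pi, pi], |e^{ix} - e^{iy}| is bounded below when
    y is in [-pi, pi] and away from x; 2 pi - d bounds |x - y|. *)
Lemma cos_le_away (d x y : R) : 0 < d -> - pi + d <= x <= pi - d -> I y ->
  d <= `|x - y| -> cos (x - y) <= cos d.
Proof.
move=> d0 /andP[x1 x2]; rewrite /= in_itv /= => /andP[y1 y2] dxy.
have dpi : d <= pi by have := le_trans x1 x2; lra.
rewrite -(cos_norm (x - y)); set v := `|x - y| in dxy *.
have v2 : v <= 2 * pi - d by rewrite /v ler_norml; apply/andP; split; lra.
have main u : d <= u -> u <= pi -> cos u <= cos d.
  move=> du upi; rewrite leNgt ltr_cos ?in_itv /= -?leNgt//; lra.
have [vpi|pv] := leP v pi; first exact: main.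
rewrite -(cosN v) -(cosD2pi (- v)); apply: main; rewrite -mulr_natl; lra.
Qed.

(** Since g is not assumed to be periodic, the end points are excluded. *)
Lemma fejer_cvg_pointwise g x : continuous g -> x \in `]- pi, pi[ ->
  (fun n => fejer_mean n.+1 g x) @ \oo --> g x.
Proof.
move=> cg; rewrite in_itv /= => /andP[x1 x2].
have [B B0 gB] : exists2 B, 0 <= B & forall y, I y -> `|g y| <= B.
  have cptI : compact I by exact: segment_compact.
  have /compact_bounded[M [_ mrt]] :=
    continuous_compact (continuous_subspaceT cg) cptI.
  exists (`|M| + 1); first by rewrite addr_ge0.
  by move=> y Iy; apply: mrt; [rewrite ltr_pwDr// ler_norm | exists y].
apply/cvgrPdist_le => e e0.
have e20 : 0 < e / 2 by rewrite divr_gt0.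
have /cvgrPdist_le /(_ _ e20) /nbhs_ballP[d1 /= d10 gd1] := cg x.
have [d [d0 dd1 dx1 dx2]] : exists d : R,
    [/\ 0 < d, d <= d1, - pi + d <= x & x <= pi - d].
  exists (Num.min d1 (Num.min (x + pi) (pi - x))); split.
  - by rewrite !lt_min d10; apply/andP; split => //; apply/andP; split; lra.
  - by rewrite ge_min lexx.
  - by have : Num.min d1 (Num.min (x + pi) (pi - x)) <= x + pi;
      [rewrite !ge_min lexx orbT | lra].
  - by have : Num.min d1 (Num.min (x + pi) (pi - x)) <= pi - x;
      [rewrite !ge_min lexx !orbT | lra].
have c0 : 0 < 2 - 2 * cos d.
  have : cos d < cos 0.
    rewrite ltr_cos ?in_itv //=; have := pi_gt0 R; lra.
  by rewrite cos0; lra.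
set c := 2 - 2 * cos d in c0.
(* a Korovkin estimate: continuity at x near x, boundedness elsewhere *)
have key y : I y -> `|g y - g x| <= e / 2 + (2 * B / c) * (2 - 2 * cos (x - y)).
  move=> Iy; have k0 : 0 <= 2 - 2 * cos (x - y) by have := cos_le1 (x - y); lra.
  have Bc : 0 <= 2 * B / c by rewrite divr_ge0 ?mulr_ge0// ltW.
  have [xy|dxy] := ltP `|x - y| d.
    apply: ler_wpDr; first exact: mulr_ge0.
    by rewrite distrC; apply: gd1; rewrite /ball /= (lt_le_trans xy).
  apply: ler_wpDl; first exact: ltW.
  have cc : c <= 2 - 2 * cos (x - y).
    have := @cos_le_away d x y d0 _ Iy dxy; rewrite /c => H.
    have : cos (x - y) <= cos d by apply: H; apply/andP; split.
    lra.
  apply: (@le_trans _ _ (2 * B)).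
    apply: le_trans (ler_normB _ _) _; rewrite mulr_natl mulr2n lerD ?gB//.
    by rewrite /= in_itv /=; apply/andP; split; apply: ltW.
  rewrite -(mulrA (2 * B)) -[leLHS](mulr1 (2 * B)) ler_wpM2l ?mulr_ge0//.
  by rewrite ler_pdivlMl// mulr1.
have := nbhs_infty_ger ((e / 2)^-1 * (2 * B / c * 4)).
apply: filterS => n nB.
have N0 : (0 < n.+1)%N by [].
have ig : itg g by exact: continuous_itg.
have igx : itg (fun=> g x) by exact: itg_cst.
rewrite distrC.
have -> : fejer_mean n.+1 g x - g x = fejer_mean n.+1 (fun y => g y - g x) x.
  rewrite fejer_meanB//; congr (_ - _); rewrite /fejer_mean.
  have := meanZ (g x) (itg_fejer n.+1 x (itg_cst 1)).
  have -> : mean (fun y => fejer n.+1 (x - y) * 1) = 1 by exact: fejer_mean1.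
  rewrite mulr1 => E; rewrite -[LHS]E; apply: eq_mean => y _; ring.
apply: le_trans (ler_norm_fejer_mean _ _ _) _; first exact: itgB.
apply: (@le_trans _ _ (mean (fun y => e / 2 * (fejer n.+1 (x - y) * 1) +
    (2 * B / c * (4 / n.+1%:R))))).
  apply: le_mean.
  - exact/itg_fejer/itg_abs/itgB.
  - by apply: itgD; [exact/itgZ/itg_fejer/itg_cst | exact: itg_cst].
  move=> y Iy; apply: le_trans (ler_wpM2l (fejer_ge0 _ _) (key y Iy)) _.
  rewrite mulrDr mulr1 mulrC lerD2l mulrCA ler_wpM2l//.
    by rewrite divr_ge0 ?mulr_ge0// ltW.
  exact: fejer_moment.
rewrite meanD; last 2 first.
- exact/itgZ/itg_fejer/itg_cst.
- exact: itg_cst.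
rewrite mean_cst meanZ; last exact/itg_fejer/itg_cst.
have -> : mean (fun y => fejer n.+1 (x - y) * 1) = 1 by exact: fejer_mean1.
rewrite mulr1 [leRHS](splitr e) lerD2l mulrA ler_pdivrMr ?ltr0n//.
rewrite -ler_pdivrMl//.
by apply: le_trans nB _; rewrite ler_nat.
Qed.

Lemma integral_norm_mean h : itg h ->
  (\int[mu]_(x in I) `|(h x)%:E| = (2 * pi * mean (fun x => `|h x|))%:E)%E.
Proof.
move=> hh; rewrite /mean mulrA divff ?gt_eqF ?pi2_gt0// mul1r /Rintegral.
rewrite fineK//; apply: integrable_fin_num; first exact: measurable_period.
exact: itg_abs.
Qed.

Lemma fejer_cvg_L1_continuous g : continuous g -> forall e : R, 0 < e ->
  \forall n \near \oo, mean (fun x => `|fejer_mean n.+1 g x - g x|) < e.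
Proof.
move=> cg e e0; have ig : itg g by exact: continuous_itg.
have [B gB] : exists B, forall y, I y -> `|g y| <= B.
  have cptI : compact I by exact: segment_compact.
  have /compact_bounded[M [_ mrt]] :=
    continuous_compact (continuous_subspaceT cg) cptI.
  exists (`|M| + 1).
  by move=> y Iy; apply: mrt; [rewrite ltr_pwDr// ler_norm | exists y].
have [] := @dominated_convergence _ _ R mu I (measurable_period)
  (fun n x => (fejer_mean n.+1 g x)%:E) (EFin \o g) (cst B%:E).
- move=> n; apply/measurable_EFinP.
  by have /measurable_int/measurable_EFinP := itg_fejer_mean n.+1 ig.
- by have /measurable_int := ig.
- exists [set - pi; pi]; split => //.
  + by apply: measurableU; exact: measurable_set1.
  + by apply: countable_lebesgue_measure0; exact: finite_set_countable.
  + move=> x /= H; apply: contrapT => xpi; apply: H => Ix.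
    apply: cvg_EFin; first exact: nearW.
    apply: fejer_cvg_pointwise => //; move: Ix xpi; rewrite !in_itv /=.
    rewrite !lt_neqAle => /andP[-> ->]; rewrite !andbT => xpi.
    by apply/andP; split; apply/eqP => xE; apply: xpi; [left|right].
- exact: itg_cst.
- apply: aeW => x n Ix; rewrite /= lee_fin.
  apply: le_trans (ler_norm_fejer_mean _ _ ig) _.
  have <- : fejer_mean n.+1 (fun=> B * 1) x = B.
    by rewrite fejer_meanZ ?fejer_mean1 ?mulr1//; exact: itg_cst.
  by apply: le_fejer_mean => [||y Iy]; [exact: itg_abs|exact: itg_cst|rewrite mulr1 gB].
move=> _ + _ => /fine_cvgP[_ /cvgrPdist_lt].
have e1 : 0 < 2 * pi * e by rewrite mulr_gt0// pi2_gt0.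
move=> /(_ _ e1); apply: filterS => n.
have E := integral_norm_mean (itgB (itg_fejer_mean n.+1 ig) ig).
rewrite /= [X in fine X](_ : _ = (2 * pi * mean (fun x =>
  `|fejer_mean n.+1 g x - g x|))%:E); last exact: E.
rewrite /= sub0r normrN ger0_norm; first by rewrite ltr_pM2l// pi2_gt0.
by rewrite mulr_ge0 ?(ltW (pi2_gt0))//; apply: mean_ge0 => x _.
Qed.

Lemma continuous_dense_L1 h : itg h -> forall e : R, 0 < e ->
  exists2 g, continuous g & mean (fun x => `|h x - g x|) < e.
Proof.
move=> ih e e0.
have muI : (mu I < +oo)%E.
  by rewrite [X in (X < _)%E](_ : _ = (2 * pi)%:E) ?ltry//; exact: measure_period.
have [g_ [cg ig]] :=
  approximation_continuous_integrable measurable_period muI ih.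
move=> /fine_cvgP[_ /cvgrPdist_lt].
have e1 : 0 < 2 * pi * e by rewrite mulr_gt0// pi2_gt0.
move=> /(_ _ e1)[n _ /(_ n (leqnn n))] => gn; exists (g_ n) => //.
move: gn; rewrite /= integral_norm_mean; last by apply: itgB => //; exact: ig.
rewrite /= sub0r normrN ger0_norm; first by rewrite ltr_pM2l// pi2_gt0.
by rewrite mulr_ge0 ?(ltW (pi2_gt0))//; apply: mean_ge0 => x _.
Qed.

Lemma fejer_cvg_L1 h : itg h -> forall e : R, 0 < e ->
  \forall n \near \oo, mean (fun x => `|fejer_mean n.+1 h x - h x|) < e.
Proof.
move=> ih e e0; have e3 : 0 < e / 3 by rewrite divr_gt0.
have [g cg hg] := continuous_dense_L1 ih e3.
have ig : itg g by exact: continuous_itg.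
have ihg : itg (fun x => h x - g x) by exact: itgB.
have := fejer_cvg_L1_continuous cg e3; apply: filterS => n fg.
have i1 : itg (fun x => `|fejer_mean n.+1 (fun y => h y - g y) x|).
  exact/itg_abs/itg_fejer_mean.
have i2 : itg (fun x => `|fejer_mean n.+1 g x - g x|).
  exact/itg_abs/itgB/ig/itg_fejer_mean.
have i3 : itg (fun x => `|h x - g x|) by exact: itg_abs.
apply: (@le_lt_trans _ _ (mean (fun x => `|fejer_mean n.+1 (fun y => h y - g y) x|
   + `|fejer_mean n.+1 g x - g x| + `|h x - g x|))).
  apply: le_mean.
  - exact/itg_abs/itgB/ih/itg_fejer_mean.
  - by apply: itgD => //; exact: itgD.
  move=> x _; rewrite fejer_meanB//.
  rewrite (distrC (h x)).
  apply: le_trans (lerD (ler_normD _ _) (lexx _)).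
  apply: le_trans (ler_normD _ _); rewrite le_eqVlt; apply/orP; left.
  by apply/eqP; congr (`| _ |); ring.
rewrite meanD//; last exact: itgD.
rewrite meanD//.
have := mean_fejer_mean (ltn0Sn n) ihg; lra.
Qed.

(** |s_N f| <= s_N |f| for f = f1 + i f2 and g = |f|. *)
Lemma fejer_mean_complex_le N (f1 f2 g : R -> R) x : itg f1 -> itg f2 -> itg g ->
  (forall y, f1 y ^+ 2 + f2 y ^+ 2 = g y ^+ 2) -> (forall y, 0 <= g y) ->
  fejer_mean N f1 x ^+ 2 + fejer_mean N f2 x ^+ 2 <= fejer_mean N g x ^+ 2.
Proof.
move=> i1 i2 ig fg g0; set a := fejer_mean N f1 x; set b := fejer_mean N f2 x.
set s := a ^+ 2 + b ^+ 2; have s0 : 0 <= s by rewrite addr_ge0 ?sqr_ge0.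
(* rotate f so that its Fejer mean at x becomes real *)
have sE : s = fejer_mean N (fun y => a * f1 y + b * f2 y) x.
  by rewrite fejer_meanD ?fejer_meanZ ?expr2//; exact: itgZ.
have : s <= Num.sqrt s * fejer_mean N g x.
  rewrite {1}sE -fejer_meanZ//; apply: le_fejer_mean.
  - by apply: itgD; exact: itgZ.
  - exact: itgZ.
  move=> y _; apply: le_trans (ler_norm _) _.
  rewrite -(@ler_pXn2r _ 2)// ?nnegrE ?mulr_ge0 ?sqrtr_ge0//.
  rewrite real_normK ?num_real// exprMn sqr_sqrtr// -fg /s.
  have := sqr_ge0 (a * f2 y - b * f1 y); nra.
have [->|sn0] := eqVneq s 0; first by rewrite sqr_ge0.
have sp : 0 < Num.sqrt s by rewrite sqrtr_gt0 lt_neqAle eq_sym sn0.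
rewrite -{1}(sqr_sqrtr s0) expr2 ler_pM2l// => le.
by rewrite -(sqr_sqrtr s0) ler_pXn2r ?nnegrE ?sqrtr_ge0 ?fejer_mean_ge0.
Qed.

End fejer.

(** * Absolute continuity of the norm *)

Section absolute_continuity.
Context {R : realType} (rho : (circle R -> \bar R) -> \bar R).
Hypothesis Hrho : banach_function_norm rho.
Local Notation m := (@circle_measure R).
Local Notation normc := (@Normc.normc R).
Implicit Types (g h : circle R -> R) (E F : set (circle R)).

(** Nonnegative, finite-valued measurable functions. *)
Definition L0r g := measurable_fun setT g /\ forall t, 0 <= g t.

(** The function norm on finite-valued functions. *)
Definition rnorm g : \bar R := rho (fun t => (g t)%:E).

Lemma L0rp g : L0r g -> L0p (fun t => (g t)%:E).
Proof.
by move=> [mg g0]; split; [exact/measurable_EFinP|move=> t; rewrite lee_fin].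
Qed.

Lemma rnorm_ge0 g : L0r g -> (0 <= rnorm g)%E.
Proof. by move=> /L0rp; exact: bfn_ge0. Qed.

Lemma le_rnorm g h : L0r g -> L0r h -> (forall t, g t <= h t) ->
  (rnorm g <= rnorm h)%E.
Proof.
move=> /L0rp g0 /L0rp h0 gh; apply: (bfn_le Hrho) => //.
by apply: aeW => t; rewrite lee_fin.
Qed.

Lemma rnormD g h : L0r g -> L0r h ->
  (rnorm (fun t => g t + h t)%R <= rnorm g + rnorm h)%E.
Proof. by move=> /L0rp g0 /L0rp h0; have := bfn_triangle Hrho g0 h0. Qed.

Lemma rnormZ (a : R) g : 0 <= a -> L0r g ->
  rnorm (fun t => a * g t) = (a%:E * rnorm g)%E.
Proof. by move=> a0 /L0rp g0; have := bfn_scale Hrho a0 g0. Qed.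

Lemma L0rD g h : L0r g -> L0r h -> L0r (fun t => g t + h t).
Proof.
move=> [mg g0] [mh h0]; split; first exact: measurable_funD.
by move=> t; rewrite addr_ge0.
Qed.

Lemma L0rM g h : L0r g -> L0r h -> L0r (fun t => g t * h t).
Proof.
move=> [mg g0] [mh h0]; split; first exact: measurable_funM.
by move=> t; rewrite mulr_ge0.
Qed.

Lemma L0r_cst (a : R) : 0 <= a -> L0r (fun=> a).
Proof. by move=> a0; split. Qed.

Lemma L0r_indic E : measurable E -> L0r (\1_E).
Proof. by move=> mE; split => [|t]; [exact: measurable_indic|rewrite indicE]. Qed.

(** The product of g with the indicator function of E. *)
Definition cut E g : circle R -> R := fun t => g t * \1_E t.

Lemma cutE E g t : cut E g t = if t \in E then g t else 0.
Proof. by rewrite /cut indicE; case: ifP => _; rewrite ?mulr1 ?mulr0. Qed.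

Lemma L0r_cut E g : measurable E -> L0r g -> L0r (cut E g).
Proof. by move=> mE hg; apply: L0rM => //; exact: L0r_indic. Qed.

Lemma L0_normc (f : circle R -> R[i]) : L0 f -> L0r (fun t => normc (f t)).
Proof.
move=> [mr mi]; split => [|t]; last exact: normc_ge0.
rewrite (_ : (fun t => _) = @Num.sqrt R \o
  (fun t => complex.Re (f t) ^+ 2 + complex.Im (f t) ^+ 2)); last first.
  by apply/funext => t /=; case: (f t).
apply: measurableT_comp.
  by apply: continuous_measurable_fun; exact: sqrt_continuous.
by apply: measurable_funD; exact: measurable_funX.
Qed.

Lemma L0B (f g : circle R -> R[i]) : L0 f -> L0 g -> L0 (fun t => f t - g t).
Proof.
move=> [fr fi] [gr gi]; split.
  rewrite (_ : (fun t => _) = fun t => complex.Re (f t) - complex.Re (g t)).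
    exact: measurable_funB.
  by apply/funext => t; rewrite Re_add Re_opp.
rewrite (_ : (fun t => _) = fun t => complex.Im (f t) - complex.Im (g t)).
  exact: measurable_funB.
by apply/funext => t; rewrite Im_add Im_opp.
Qed.

Lemma L0_real g : measurable_fun setT g -> L0 (fun t => (g t)%:C).
Proof. by move=> mg; split => //=. Qed.

Hypothesis Hsep : bfs_separable rho.

(** Separability, through a diagonal argument that replaces the uncountable
    separated family of all g 1_{U_{j in S} F_j}. *)
Lemma no_disjoint_lower_bound g (F : nat -> set (circle R)) (e : R) :
  L0r g -> (rnorm g < +oo)%E -> (forall j, measurable (F j)) ->
  trivIset setT F -> 0 < e -> ~ (forall j, (e%:E <= rnorm (cut (F j) g))%E).
Proof.
move=> hg gfin mF tF e0 eF.
have [D /countable_injP[num numI] [DX dense]] := Hsep.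
have [eta eta0 eE] : exists2 eta : R, 0 < eta & e = eta + eta.
  by exists (e / 2); [rewrite divr_gt0 | rewrite -splitr].
have L0D x : D x -> L0 x by move=> /DX[].
have nD x : D x -> L0r (fun t => normc (x t)) by move=> /L0D/L0_normc.
(* j is in S exactly when the j-th dense function is small on F j, so that
   g 1_A is far from it on F j in either case *)
pose S : set nat := [set j | exists2 x, D x & num x = j /\
  (rnorm (cut (F j) (fun t => normc (x t))) < eta%:E)%E].
pose A := \bigcup_(j in S) F j.
have mA : measurable A by apply: bigcup_measurable => j _.
pose h : circle R -> R[i] := fun t => (cut A g t)%:C.
have hX : bfs rho h.
  split; first by apply: L0_real; have [] := L0r_cut mA hg.
  rewrite /bfs_norm (_ : (fun t => _) = fun t => (cut A g t)%:E); last first.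
    apply/funext => t; congr EFin.
    by rewrite /h /= expr0n addr0 sqrtr_sqr ger0_norm// (L0r_cut mA hg).2.
  apply: le_lt_trans gfin; apply: le_rnorm => //; first exact: L0r_cut.
  by move=> t; rewrite cutE; case: ifP => // _; exact: hg.2.
have [x Dx hx] := dense _ hX _ eta0.
set j := num x.
have hxr : L0r (fun t => normc (h t - x t)).
  by apply: L0_normc; apply: L0B; [exact: hX.1|exact: L0D].
have cx : L0r (cut (F j) (fun t => normc (x t))).
  by apply: L0r_cut => //; exact: nD.
have [jS|jS] := pselect (S j).
  have [y Dy [yj ylt]] := jS.
  have yx : y = x by apply: numI; rewrite ?inE.
  rewrite {}yx in ylt.
  have := eF j; rewrite leNgt => /negP; apply.
  apply: (@le_lt_trans _ _ (rnorm (fun t => normc (h t - x t)%R +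
     cut (F j) (fun t => normc (x t)) t)%R)).
    apply: le_rnorm; [exact: L0r_cut|exact: L0rD|].
    move=> t; rewrite !cutE; case: ifPn => [/set_mem tF'|_].
      have -> : g t = normc (h t).
        rewrite /h cutE mem_set; last by exists j.
        by rewrite /= expr0n addr0 sqrtr_sqr ger0_norm// hg.2.
      rewrite -[X in normc X](subrK (x t)).
      exact: le_normcD.
    by rewrite addr0 normc_ge0.
  by apply: le_lt_trans (rnormD hxr cx) _; rewrite eE EFinD lteD.
apply: (jS); exists x => //; split => //.
apply: le_lt_trans hx; apply: le_rnorm => // t; rewrite cutE.
case: ifPn => [/set_mem tj|_]; last exact: normc_ge0.
have -> : h t = 0.
  rewrite /h cutE; case: ifPn => // /set_mem[i Si Fi].
  have ij : i = j by apply: (tF i j) => //; exists t.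
  by case: jS; rewrite -ij.
by rewrite sub0r normcN.
Qed.

(** The norm of g 1_{E_k} tends to 0 when the sets E_k decrease to a null set.
    If not, the Fatou property extracts disjoint sets E_{n_j} - E_{n_(j+1)} on
    which g keeps a norm at least e/2. *)
Lemma rnorm_cut_decreasing g (E : nat -> set (circle R)) (e : R) :
  L0r g -> (rnorm g < +oo)%E -> (forall k, measurable (E k)) ->
  (forall k l, (k <= l)%N -> E l `<=` E k) -> m (\bigcap_k E k) = 0%E -> 0 < e ->
  exists k, (rnorm (cut (E k) g) < e%:E)%E.
Proof.
move=> hg gfin mE dE E0 e0; apply: contrapT => /forallNP noE.
have eE k : (e%:E <= rnorm (cut (E k) g))%E.
  by rewrite leNgt; apply/negP; exact: noE.
have e20 : 0 < e / 2 by rewrite divr_gt0.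
have step k : exists l, (k <= l)%N /\
    ((e / 2)%:E <= rnorm (cut (E k `\` E l) g))%E.
  have mD l : measurable (E k `\` E l) by exact: measurableD.
  have ae : {ae m, forall t,
      nondecreasing_seq (fun l => (cut (E k `\` E l) g t)%:E) /\
      (cut (E k `\` E l) g t)%:E @[l --> \oo] --> (cut (E k) g t)%:E}.
    exists (\bigcap_k E k); split => //; first exact: bigcapT_measurable.
    move=> t /= H l _; apply: contrapT => Elt; apply: H; split.
      move=> a b ab; rewrite lee_fin !cutE.
      case: ifPn => [/set_mem[ka na]|_]; last first.
        by case: ifPn => // _; exact: hg.2.
      by rewrite mem_set//; split => // /(dE _ _ ab).
    apply: cvg_near_cst; exists l => // b /= lb; congr EFin; rewrite !cutE.
    case: (pselect (E k t)) => [kt|nkt].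
      by rewrite !mem_set//; split => // /(dE _ _ lb).
    by rewrite !memNset// => -[].
  have [_ cv] := bfn_fatou Hrho (f_ := fun l t => (cut (E k `\` E l) g t)%:E)
    (f := fun t => (cut (E k) g t)%:E)
    (fun l => L0rp (L0r_cut (mD l) hg)) (L0rp (L0r_cut (mE k) hg)) ae.
  have lt : ((e / 2)%:E < rnorm (cut (E k) g))%E.
    by apply: lt_le_trans (eE k); rewrite lte_fin ltr_pdivrMr// ltr_pMr// ltr1n.
  apply: contrapT => /forallNP nol.
  move: lt; rewrite ltNge => /negP; apply.
  rewrite /rnorm -(cvg_lim _ cv)//.
  apply: lime_le; first by apply/cvg_ex; eexists; exact: cv.
  exists k => // l /= kl; rewrite leNgt; apply/negP => /ltW le.
  by apply: (nol l); split.
have [phi phiP] := choice step.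
pose n := fix n j := if j is j'.+1 then phi (n j') else 0%N.
have n_mono i j : (i <= j)%N -> (n i <= n j)%N.
  move=> /subnK <-; elim: (j - i)%N => // d IH.
  by apply: leq_trans IH _; exact: (phiP _).1.
apply: (@no_disjoint_lower_bound g (fun j => E (n j) `\` E (n j.+1)) (e / 2)) => //.
- by move=> j; exact: measurableD.
- apply: ltn_trivIset => a b ab.
  rewrite -subset0 => t [[_ na] [nb _]]; apply: na.
  exact: (dE _ _ (n_mono _ _ ab)).
- by move=> j; exact: (phiP (n j)).2.
Qed.

Lemma rnorm_absolutely_continuous g (e : R) :
  L0r g -> (rnorm g < +oo)%E -> 0 < e ->
  exists2 d : R, 0 < d & forall E, measurable E -> (m E < d%:E)%E ->
    (rnorm (cut E g) < e%:E)%E.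
Proof.
move=> hg gfin e0; apply: contrapT => noD.
(* summable measures, so that the limit superior of the E k is null *)
have /choice[E EP] k : exists E, [/\ measurable E,
    (m E < (1 / (2 ^ k.+1)%:R)%:E)%E & (e%:E <= rnorm (cut E g))%E].
  apply: contrapT => H; apply: noD; exists (1 / (2 ^ k.+1)%:R).
    by rewrite divr_gt0// ltr0n expn_gt0.
  move=> E mE Ek; rewrite ltNge; apply/negP => eE; apply: H; exists E.
  by split.
have mE k : measurable (E k) by have [] := EP k.
pose A k := \bigcup_(j in [set j | (k <= j)%N]) E j.
have mA k : measurable (A k) by apply: bigcup_measurable => j _.
have [||k] := @rnorm_cut_decreasing g A e hg gfin mA _ _ e0.
- by move=> k l kl t [j /= lj Ejt]; exists j => //=; exact: leq_trans lj.
- apply: lim_sup_set_cvg0 => //.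
  apply: (@le_lt_trans _ _ 1%:E); last by rewrite ltry.
  apply: le_trans (epsilon_trick0 xpredT (@ler01 R)).
  by apply: lee_nneseries => // k _; have [_ /ltW] := EP k.
rewrite ltNge => /negP; apply.
have [_ _ /le_trans] := EP k; apply; apply: le_rnorm.
- exact: L0r_cut.
- exact: L0r_cut.
move=> t; rewrite !cutE; case: ifPn => [/set_mem tE|_].
  by rewrite mem_set//; exists k => /=.
by case: ifPn => // _; exact: hg.2.
Qed.

End absolute_continuity.

(** * Integration and polynomials on the circle *)

Section circle_bridge.
Context {R : realType}.
Local Notation mu := (@lebesgue_measure R).
Local Notation m := (@circle_measure R).
Local Notation I := (`[- pi, pi]%classic : set R).
Local Notation itg := (@summable_period R).
Local Notation Re := (@complex.Re R).
Local Notation Im := (@complex.Im R).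
Local Notation normc := (@Normc.normc R).

Lemma measurable_circle_coord : measurable_fun setT (@circle_coord R).
Proof. by move=> _ B mB; rewrite setTI; exists B => //; rewrite setTI. Qed.

Lemma L0_poly (p : {poly R[i]}) : L0 (fun t : circle R => p.[\val t]).
Proof.
have mr : measurable_fun setT (fun t : circle R => Re (\val t)).
  exact: (measurableT_comp (@measurable_fst _ _ R R) measurable_circle_coord).
have mi : measurable_fun setT (fun t : circle R => Im (\val t)).
  exact: (measurableT_comp (@measurable_snd _ _ R R) measurable_circle_coord).
elim/poly_ind: p => [|p c [IHr IHi]].
  by split; under eq_fun do rewrite horner0 /=; exact: measurable_cst.
split; under eq_fun do rewrite hornerMXaddC ?(Re_add, Im_add) ?(Re_mul, Im_mul) /=.
  apply: measurable_funD => //.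
  by apply: measurable_funB; exact: measurable_funM.
apply: measurable_funD => //.
by apply: measurable_funD; exact: measurable_funM.
Qed.

Lemma measurable_comp_cis (h : circle R -> R) : measurable_fun setT h ->
  measurable_fun (I : set (measurableTypeR R)) (fun x => h (cis x)).
Proof.
move=> mh; apply: measurable_funTS.
exact: (measurableT_comp mh (@measurable_cis R)).
Qed.

Lemma circle_measureE (E : set (circle R)) :
  m E = ((2 * pi)^-1%:E * mu (@cis R @^-1` E `&` I))%E.
Proof. by []. Qed.

Lemma circle_chebyshev (h : circle R -> R) (a : R) : measurable_fun setT h ->
  itg (fun x => h (cis x)) -> 0 < a ->
  (m [set t | (a <= `|h t|)%R] <= (mean (fun x => `|h (cis x)|) / a)%R%:E)%E.
Proof.
move=> mh ih a0; rewrite circle_measureE.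
have := @le_integral_comp_abse _ _ R mu I measurable_period
  (fun x => (h (cis x))%:E) a id _ _ _ _ a0.
rewrite integral_norm_mean// => /(_ _ _ _ _)H.
have {H} : (a%:E * mu (I `&` [set x | (a%:E <= `|(h (cis x))%:E|)%E]) <=
    (2 * pi * mean (fun x => `|h (cis x)|))%:E)%E.
  apply: H => //.
    by apply/measurable_EFinP; exact: measurable_comp_cis.
rewrite setIC.
rewrite (_ : [set x | (a%:E <= `|(h (cis x))%:E|)%E] =
  @cis R @^-1` [set t | a <= `|h t|]); last by apply/funext => x /=; rewrite lee_fin.
set M := mu _ => le.
rewrite lee_pdivrMl ?pi2_gt0// -EFinM.
rewrite (_ : 2 * pi * _ = a^-1 * (2 * pi * mean (fun x => `|h (cis x)|))).
  by rewrite EFinM lee_pdivlMl.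
by ring.
Qed.

Lemma integral_circle_ge0 (h : circle R -> R) : measurable_fun setT h ->
  (forall t, 0 <= h t) ->
  (\int[m]_t (h t)%:E = (2 * pi)^-1%:E * \int[mu]_(x in I) (h (cis x))%:E)%E.
Proof.
move=> mh h0; have mhE : measurable_fun setT (EFin \o h) by exact/measurable_EFinP.
have mhc : measurable_fun (setT : set (measurableTypeR R)) (fun x => (h (cis x))%:E).
  exact: (measurableT_comp mhE (@measurable_cis R)).
rewrite ge0_integral_pushforward//=; last by move=> t _; rewrite lee_fin.
rewrite ge0_integral_mscale//=; [|by rewrite preimage_setT; exact: measurableT|
  by move=> t _; rewrite lee_fin].
congr (_ * _)%E; rewrite preimage_setT -(setUv I).
have mI := @measurable_period R.
rewrite ge0_integral_setU//=; [|exact: measurableC|by rewrite setUv|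
  by move=> t _; rewrite lee_fin|exact/disj_setPCl].
rewrite [X in (_ + X)%E](_ : _ = 0%E) ?adde0.
  apply: eq_measure_integral => A mA AI.
  by rewrite /= /mrestr; congr (mu _); apply: setIidl.
rewrite (eq_measure_integral mzero) ?integral_measure_zero// => A mA AI.
rewrite /= /mrestr /mzero.
rewrite (_ : A `&` _ = set0) ?measure0//.
by rewrite -subset0 => x [/AI].
Qed.

Section norm.
Variables (rho : (circle R -> \bar R) -> \bar R).
Hypothesis Hrho : banach_function_norm rho.

(** Functions of X are integrable: the embedding of X in L^1. *)
Lemma bfs_itg (f : circle R -> R[i]) : bfs rho f ->
  itg (fun x => normc (f (cis x))).
Proof.
move=> [Lf ffin]; have [mf f0] := L0_normc Lf.
have [C [C0 HC]] := bfn_L1 Hrho (@measurableT _ (circle R)).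
have := HC _ (L0rp (L0_normc Lf)); rewrite integral_circle_ge0// => le.
apply/integrableP; split.
  by apply/measurable_EFinP; exact: (measurable_comp_cis mf).
under eq_integral do rewrite /= ger0_norm ?f0//.
rewrite ltey; apply/eqP => E; move: le.
rewrite E mulry gtr0_sg ?invr_gt0 ?pi2_gt0// mul1e leye_eq => /eqP.
have : (C%:E * rho (fun t => (normc (f t))%:E) < +oo)%E.
  by rewrite lte_mul_pinfty// ltW// lte_fin.
by move=> + H; rewrite H.
Qed.

Lemma bfs_itg_ReIm (f : circle R -> R[i]) : bfs rho f ->
  itg (fun x => Re (f (cis x))) /\ itg (fun x => Im (f (cis x))).
Proof.
move=> fX; have [mr mi] := fX.1; split; apply: itg_le (bfs_itg fX).
- exact: (measurable_comp_cis mr).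
- by move=> x _; exact: Re_le_normc.
- exact: (measurable_comp_cis mi).
- by move=> x _; exact: Im_le_normc.
Qed.

End norm.

Lemma fourier_coefN (f : circle R -> R[i]) k :
  itg (fun x => Re (f (cis x))) -> itg (fun x => Im (f (cis x))) ->
  fourier_coef f (- k%:Z) =
  (mean (fun x => cos (k%:R * x) * Re (f (cis x))) -
   mean (fun x => sin (k%:R * x) * Im (f (cis x)))) +i*
  (mean (fun x => sin (k%:R * x) * Re (f (cis x))) +
   mean (fun x => cos (k%:R * x) * Im (f (cis x)))).
Proof.
move=> i1 i2; rewrite -meanB; [|exact: itg_cosM|exact: itg_sinM].
rewrite -meanD; [|exact: itg_sinM|exact: itg_cosM].
have E x : - ((- k%:Z)%:~R * x) = k%:R * x by rewrite rmorphN /= mulNr opprK.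
rewrite /fourier_coef /cintegral; apply: complex_eqP; rewrite ?Re_mul ?Im_mul /= mul0r.
  rewrite subr0; congr (_ * _); apply: eq_Rintegral => x _.
  by rewrite E Re_mul /=; ring.
rewrite addr0; congr (_ * _); apply: eq_Rintegral => x _.
by rewrite E Im_mul /=; ring.
Qed.

(** The Fejer means of a function whose negative Fourier coefficients vanish
    are analytic polynomials. *)
Lemma fejer_mean_analytic (f : circle R -> R[i]) N :
  itg (fun x => Re (f (cis x))) -> itg (fun x => Im (f (cis x))) ->
  (forall n : int, n < 0 -> fourier_coef f n = 0) ->
  exists p : {poly R[i]}, forall x,
    Re p.[expi x] = fejer_mean N (fun x => Re (f (cis x))) x /\
    Im p.[expi x] = fejer_mean N (fun x => Im (f (cis x))) x.
Proof.
move=> i1 i2 f0; set f1 := fun x => Re (f (cis x)) in i1 *.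
set f2 := fun x => Im (f (cis x)) in i2 *.
pose A (h : R -> R) (k : nat) := N%:R^-1 * mean (fun x => cos (k%:R * x) * h x).
pose B (h : R -> R) (k : nat) := N%:R^-1 * mean (fun x => sin (k%:R * x) * h x).
have B0 h : B h 0%N = 0.
  rewrite /B (_ : mean _ = 0) ?mulr0// -[RHS](@mean_cst R).
  by apply: eq_mean => x _; rewrite mul0r sin0 mul0r.
(* the vanishing of the coefficient of index -k reads
   A f2 k - i B f2 k = - i (A f1 k - i B f1 k) *)
have AB k : (0 < k)%N -> A f1 k = B f2 k /\ B f1 k = - A f2 k.
  move=> k0; have := f0 (- k%:Z); rewrite oppr_lt0 ltz_nat => /(_ k0).
  rewrite fourier_coefN// => -[/eqP + /eqP].
  rewrite subr_eq0 addr_eq0 => /eqP E1 /eqP E2.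
  by rewrite /A /B E1 E2 mulrN.
pose d k : R[i] := if k == 0%N then A f1 0%N +i* A f2 0%N else A f1 k -i* B f1 k.
exists (\sum_(j < N) \sum_(l < N) d (j - l + (l - j))%N *: 'X^(j - l + (l - j))).
move=> x; have dE k : Re (d k * expi (k%:R * x)) =
     A f1 k * cos (k%:R * x) + B f1 k * sin (k%:R * x) /\
   Im (d k * expi (k%:R * x)) =
     A f2 k * cos (k%:R * x) + B f2 k * sin (k%:R * x).
  rewrite Re_mul Im_mul /d; case: k => [|k] /=.
    by rewrite !mul0r cos0 sin0 !mulr0 !mulr1 !addr0 subr0 add0r.
  by have [-> ->] := AB k.+1 isT; split; ring.
rewrite !fejer_meanE// horner_sum Re_sum Im_sum.
split; apply: eq_bigr => j _; rewrite horner_sum ?Re_sum ?Im_sum;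
  apply: eq_bigr => l _; rewrite hornerZ hornerXn expiX.
  by rewrite (dE _).1.
by rewrite (dE _).2.
Qed.

Lemma Im_fejer_poly0 N (h : R -> R) : Im (fejer_poly N h).[0] = 0.
Proof.
rewrite horner_sum Im_sum big1// => j _; rewrite horner_sum Im_sum big1// => l _.
rewrite hornerZ hornerXn expr0n.
case: eqP => [->|_]; last by rewrite mulr0.
rewrite mulr1 /= (_ : mean _ = 0) ?mulr0 ?oppr0// -[RHS](@mean_cst R).
by apply: eq_mean => x _; rewrite mul0r sin0 mul0r.
Qed.

Lemma poly_circle_bounded (p : {poly R[i]}) :
  exists2 B, 0 <= B & forall x, normc p.[expi x] <= B.
Proof.
elim/poly_ind: p => [|p c [B B0 pB]].
  by exists 0 => // x; rewrite horner0 Normc.normc0.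
exists (B + normc c); first by rewrite addr_ge0 ?normc_ge0.
move=> x; rewrite hornerMXaddC; apply: le_trans (le_normcD _ _) _.
by rewrite Normc.normcM normc_expi mulr1 lerD2r.
Qed.

Lemma bernoulli_ineq (x : R) n : 0 <= x <= 1 -> 1 - n%:R * x <= (1 - x) ^+ n.
Proof.
move=> /andP[x0 x1]; elim: n => [|n IH]; first by rewrite mul0r subr0 expr0.
rewrite exprS; apply: le_trans (ler_wpM2l _ IH); last by rewrite subr_ge0.
by rewrite -natr1; have : 0 <= n%:R * x * x; [rewrite !mulr_ge0|nra].
Qed.

(** The polynomial (1 - G/M)^M, for M large, satisfies the bound of exp(-G) up
    to a factor 1 + eta.  It is close to 1 in L^2 when G(0) is small, since
    |O - 1|^2 = |O|^2 - 2 Re O + 1 and the mean of Re O is Re O(0). *)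
Lemma exp_like_poly (G : {poly R[i]}) (eta : R) : 0 < eta ->
  (forall x, 0 <= Re G.[expi x]) -> 0 <= Re G.[0] -> Im G.[0] = 0 ->
  exists O : {poly R[i]},
    (forall x, normc O.[expi x] ^+ 2 <= (1 + eta) * expR (- (2 * Re G.[expi x]))) /\
    mean (fun x => normc (O.[expi x] - 1) ^+ 2) <= eta + 2 * Re G.[0].
Proof.
move=> eta0 G0 c0 Im0; set c := Re G.[0] in c0 *.
have [B B0 GB] := poly_circle_bounded G.
(* M >= c is for the Bernoulli inequality; the other term makes
   exp (B^2 / M) at most 1 + eta *)
pose M := (Num.truncn (B ^+ 2 * (1 + eta) / eta + c)).+1.
have M0 : 0 < M%:R :> R by rewrite ltr0n.
have Mlt : B ^+ 2 * (1 + eta) / eta + c < M%:R by exact: truncnS_gt.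
have eta1 : 0 < 1 + eta by rewrite addr_gt0.
have Be0 : 0 <= B ^+ 2 * (1 + eta) / eta.
  exact: divr_ge0 (mulr_ge0 (sqr_ge0 _) (ltW eta1)) (ltW eta0).
have cM : 0 <= c / M%:R <= 1.
  rewrite divr_ge0 ?(ltW M0)//= ler_pdivrMr// mul1r; apply: ltW.
  by apply: le_lt_trans Mlt; rewrite lerDr.
have BM : expR (B ^+ 2 / M%:R) <= 1 + eta.
  have le1 : B ^+ 2 / M%:R <= eta / (1 + eta).
    rewrite ler_pdivrMr// mulrAC ler_pdivlMr// (mulrC eta) -ler_pdivrMr//.
    by apply/ltW/(le_lt_trans _ Mlt); rewrite lerDl.
  have : (1 + eta)^-1 <= expR (- (B ^+ 2 / M%:R)).
    apply: le_trans (expR_ge1Dx _).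
    have -> : (1 + eta)^-1 = 1 - eta / (1 + eta) by field; rewrite gt_eqF.
    by rewrite lerD2l lerN2.
  by rewrite expRN lef_pV2// ?posrE// expR_gt0.
pose O : {poly R[i]} := (1 - (M%:R^-1)%:C *: G) ^+ M.
have OE z : O.[z] = (1 - (M%:R^-1)%:C * G.[z]) ^+ M.
  by rewrite /O horner_exp hornerD hornerN hornerZ hornerC.
have normcX z k : normc (z ^+ k) = normc z ^+ k.
  elim: k => [|k IH]; first by rewrite !expr0 Normc.normc1.
  by rewrite !exprS Normc.normcM IH.
have O2 x : normc O.[expi x] ^+ 2 <= (1 + eta) * expR (- (2 * Re G.[expi x])).
  have := GB x; rewrite OE; set z := G.[expi x] => zB.
  have zB2 : Re z ^+ 2 + Im z ^+ 2 <= B ^+ 2.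
    by rewrite -sqr_normc_ReIm ler_pXn2r ?nnegrE ?normc_ge0.
  rewrite normcX exprAC.
  have E : expR (- (2 * Re z) / M%:R + B ^+ 2 / M%:R ^+ 2) ^+ M =
      expR (B ^+ 2 / M%:R) * expR (- (2 * Re z)).
    by rewrite -expRM_natl -expRD; congr expR; field; rewrite gt_eqF.
  apply: (@le_trans _ _ (expR (- (2 * Re z) / M%:R + B ^+ 2 / M%:R ^+ 2) ^+ M)).
    apply: lerXn2r; rewrite ?nnegrE ?sqr_ge0 ?expR_ge0//.
    apply: le_trans (expR_ge1Dx _).
    rewrite sqr_normc_ReIm Re_add Im_add Re_opp Im_opp Re_mul Im_mul /=.
    have Mi : 0 <= M%:R^-1 ^+ 2 :> R by rewrite sqr_ge0.
    have := ler_wpM2r Mi zB2; rewrite exprVn; lra.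
  by rewrite E ler_wpM2r ?expR_ge0.
exists O; split => //.
have O0 : 1 - c <= Re O.[0].
  have -> : O.[0] = ((1 - c / M%:R) ^+ M)%:C.
    rewrite OE rmorphXn; congr (_ ^+ _); apply: complex_eqP.
      by rewrite Re_add Re_opp Re_mul /= mul0r subr0 -/c [c * _]mulrC.
    by rewrite Im_add Im_opp Im_mul /= Im0 mulr0 mul0r addr0 subr0.
  apply: le_trans (bernoulli_ineq _ cM).
  by rewrite mulrCA divff ?gt_eqF// mulr1.
have iO2 : itg (fun x => normc O.[expi x] ^+ 2).
  apply: (@eq_itg R (fun x => Re O.[expi x] * Re O.[expi x] +
      Im O.[expi x] * Im O.[expi x])).
    by move=> x _; rewrite sqr_normc_ReIm !expr2.
  have [cr ci] := continuous_poly O.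
  by apply: itgD; apply: itgM_continuous => //; exact: continuous_itg.
have iR := itg_Re_poly O.
have -> : mean (fun x => normc (O.[expi x] - 1) ^+ 2) =
    mean (fun x => normc O.[expi x] ^+ 2) - 2 * Re O.[0] + 1.
  rewrite -mean_Re_poly -(meanZ 2 iR) -meanB ?(itgZ 2 iR)//.
  rewrite -[X in _ = _ + X](@mean_cst R 1) -meanD; [|exact/itgB/itgZ|exact: itg_cst].
  apply: eq_mean => x _; rewrite !sqr_normc_ReIm Re_add Im_add Re_opp Im_opp /=.
  by ring.
have : mean (fun x => normc O.[expi x] ^+ 2) <= 1 + eta.
  rewrite -(mean_cst (1 + eta)); apply: le_mean => //; first exact: itg_cst.
  move=> x _; apply: le_trans (O2 x) _; rewrite ger_pMr//.
  by rewrite -expR0 ler_expR oppr_le0 mulr_ge0.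
rewrite -/c; lra.
Qed.

End circle_bridge.

(** * Density *)

Section density.
Context {R : realType} (rho : (circle R -> \bar R) -> \bar R).
Hypothesis Hrho : banach_function_norm rho.
Local Notation m := (@circle_measure R).
Local Notation itg := (@summable_period R).
Local Notation Re := (@complex.Re R).
Local Notation Im := (@complex.Im R).
Local Notation normc := (@Normc.normc R).
Local Notation rnorm := (rnorm rho).

Lemma rnorm1_fin : (rnorm (fun=> 1%R) < +oo)%E.
Proof.
have := bfn_indic Hrho (@measurableT _ (circle R)).
rewrite circle_measureT ltry => /(_ isT).
rewrite /rnorm (_ : (fun t => (\1_setT t)%:E) = (fun=> 1%:E))//.
by apply/funext => t; rewrite indicT.
Qed.

Lemma analytic_polynomials_hardy :
  @analytic_polynomials R `<=` abstract_hardy rho.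
Proof.
move=> _ [p ->]; have [B B0 pB] := poly_circle_bounded p.
have pX : bfs rho (fun t : circle R => p.[\val t]).
  split; first exact: L0_poly.
  have L1 : L0r (fun=> 1 : R) by exact: L0r_cst.
  apply: (@le_lt_trans _ _ (rnorm (fun=> B * 1))).
    apply: le_rnorm => //; first exact/L0_normc/L0_poly.
      by rewrite mulr1; exact: L0r_cst.
    by move=> t; have [x ->] := cis_surj t; rewrite mulr1; exact: pB.
  rewrite rnormZ// lte_mul_pinfty ?lee_fin//; exact: rnorm1_fin.
split => // -[//|k _].
have -> : Negz k = - k.+1%:Z by [].
have [i1 i2] := bfs_itg_ReIm Hrho pX.
rewrite fourier_coefN//.
have [Hr Hi] := mean_polyXn p k.+1.
rewrite -meanB; [|exact: itg_cosM|exact: itg_sinM].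
rewrite -meanD; [|exact: itg_sinM|exact: itg_cosM].
apply: complex_eqP => /=.
  transitivity (mean (fun x => Re (p * 'X^(k.+1)).[expi x])).
    by apply: eq_mean => x _; rewrite hornerM hornerXn expiX Re_mul /=; ring.
  by rewrite Hr hornerM hornerXn expr0n mulr0.
transitivity (mean (fun x => Im (p * 'X^(k.+1)).[expi x])).
  by apply: eq_mean => x _; rewrite hornerM hornerXn expiX Im_mul /=; ring.
by rewrite Hi hornerM hornerXn expr0n mulr0.
Qed.

Lemma measurable_superlevel (h : circle R -> R) (a : R) :
  measurable_fun setT h -> measurable [set t | a <= h t].
Proof.
move=> mh; rewrite (_ : [set t | _] = h @^-1` `[a, +oo[%classic).
  by rewrite -[X in measurable X]setTI; apply: mh => //; exact: measurable_itv.
by apply/funext => t /=; rewrite in_itv /= andbT.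
Qed.

(** Here a and s stand for Re F_N / n and |s_N f|, and o for |O|; the constants
    come from 1 + 1/n <= 2 and a exp(-a) <= 1. *)
Lemma multiplier_bounds (n a s o : R) : 1 <= n -> 0 <= s -> s <= n * a -> 0 <= o ->
  o ^+ 2 <= (1 + 1 / n) * expR (- (2 * a)) -> o <= 2 /\ o * s <= 2 * n.
Proof.
move=> n1 s0 sa o0 oe; have n0 : 0 < n by lra.
have a0 : 0 <= a by rewrite -(pmulr_rge0 _ n0) (le_trans s0).
have en : 1 / n <= 1 by rewrite ler_pdivrMr// mul1r.
have eE : expR (- (2 * a)) = expR (- a) ^+ 2.
  by rewrite -expRM_natl; congr expR; ring.
have oe2 : o <= 2 * expR (- a).
  rewrite -(@ler_pXn2r _ 2)// ?nnegrE ?mulr_ge0 ?expR_ge0//.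
  apply: le_trans oe _; rewrite eE exprMn ler_wpM2r ?sqr_ge0//; lra.
have e1 : expR (- a) <= 1 by rewrite -expR0 ler_expR oppr_le0.
split; first by lra.
have ae : expR (- a) * a <= 1.
  rewrite expRN ler_pdivrMl ?expR_gt0// mulr1.
  by apply: le_trans (expR_ge1Dx a); rewrite lerDr.
apply: (@le_trans _ _ (2 * expR (- a) * (n * a))).
  by apply: ler_pM.
have -> : 2 * expR (- a) * (n * a) = 2 * n * (expR (- a) * a) by ring.
by rewrite ler_piMr// mulr_ge0// ltW.
Qed.

(** The estimate of |O| d + |f| q, for d = |s_N f - f|, q = |O - 1|, s = |s_N f|
    and phi = |f|, on and off the sets where d or q is at least e. *)
Lemma pointwise_split (n e o s phi d q : R) : 1 <= n -> 0 <= e ->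
  0 <= o <= 2 -> o * s <= 2 * n -> 0 <= phi -> d <= s + phi -> 0 <= q <= 3 ->
  o * d + phi * q <= 2 * e * (1 + phi) +
    2 * n * ((1 + phi) * ((e <= d)%R)%:R) + 3 * ((1 + phi) * ((e <= q)%R)%:R).
Proof.
move=> n1 e0 /andP[po0 o2] os phi0 ds /andP[q0 q3].
have H1 : o * d <= 2 * e + 2 * n * ((1 + phi) * ((e <= d)%R)%:R).
  have [ed|de] := leP e d; last by rewrite /= mulr0n !mulr0 addr0; nra.
  rewrite /= mulr1n mulr1; have : o * d <= o * (s + phi) by rewrite ler_wpM2l.
  have : o * phi <= 2 * n * phi by rewrite ler_wpM2r//; lra.
  nra.
have H2 : phi * q <= 2 * e * phi + 3 * ((1 + phi) * ((e <= q)%R)%:R).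
  have [eq|qe] := leP e q; last first.
    rewrite /= mulr0n !mulr0 addr0; have : phi * q <= phi * e by rewrite ler_wpM2l// ltW.
    have : 0 <= e * phi by rewrite mulr_ge0.
    nra.
  rewrite /= mulr1n mulr1; have : phi * q <= phi * 3 by rewrite ler_wpM2l.
  have : 0 <= e * phi by rewrite mulr_ge0.
  nra.
by rewrite mulrDr; lra.
Qed.

Lemma normc_split (n ep a : R) (z w v : R[i]) : 1 <= n -> 0 <= ep ->
  normc w <= n * a -> normc v ^+ 2 <= (1 + 1 / n) * expR (- (2 * a)) ->
  normc (z - v * w) <= 2 * ep * (1 + normc z) +
    2 * n * ((1 + normc z) * ((ep <= normc (z - w))%R)%:R) +
    3 * ((1 + normc z) * ((ep <= normc (v - 1))%R)%:R).
Proof.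
move=> n1 ep0 wa va.
have w0 := normc_ge0 w; have v0 := normc_ge0 v; have z0 := normc_ge0 z.
have [v2 vw] := multiplier_bounds n1 w0 wa v0 va.
have zw : normc (z - w) <= normc w + normc z.
  by rewrite addrC -(normcN w); exact: le_normcD.
have v1 : 0 <= normc (v - 1) <= 3.
  rewrite normc_ge0 /=; apply: le_trans (le_normcD _ _) _.
  by rewrite normcN Normc.normc1; lra.
apply: (@le_trans _ _ (normc v * normc (z - w) + normc z * normc (v - 1))).
  have -> : z - v * w = v * (z - w) - z * (v - 1) by ring.
  rewrite -!Normc.normcM -(normcN (z * _)); exact: le_normcD.
apply: (pointwise_split n1 ep0 _ vw z0 zw v1); by rewrite v0 v2.
Qed.

Hypothesis Hsep : bfs_separable rho.

(** The order of the choices matters: the threshold ep, then n, which makes the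
    set where |O - 1| >= ep small whatever N is, then N, and last O. *)
Lemma hardy_approx (f : circle R -> R[i]) (e : R) :
  abstract_hardy rho f -> 0 < e ->
  exists p : {poly R[i]},
    (bfs_norm rho (fun t => f t - p.[\val t])%R < e%:E)%E.
Proof.
move=> [fX f0] e0.
have Lf := L0_normc fX.1.
pose g t := 1 + normc (f t).
have Lg : L0r g by apply: L0rD => //; exact: L0r_cst.
have gfin : (rnorm g < +oo)%E.
  have L1 : L0r (fun=> 1 : R) by exact: L0r_cst.
  apply: le_lt_trans (rnormD Hrho L1 Lf) _.
  by rewrite lte_add_pinfty//; [exact: rnorm1_fin|exact: fX.2].
have [G0 [G00 GE]] : exists G : R, 0 <= G /\ rnorm g = G%:E.
  exists (fine (rnorm g)); split; first exact/fine_ge0/rnorm_ge0.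
  by rewrite fineK// ge0_fin_numE// rnorm_ge0.
pose ep := e / (6 * (G0 + 1)).
have ep0 : 0 < ep by rewrite divr_gt0// mulr_gt0// ltr_wpDl.
have epG : 2 * ep * G0 <= e / 3.
  rewrite /ep [leRHS](_ : _ = 2 * (e / (6 * (G0 + 1))) * (G0 + 1)).
    by rewrite ler_wpM2l ?lerDl// mulr_ge0// ltW.
  by field; rewrite gt_eqF// ltr_wpDl.
have [i1 i2] := bfs_itg_ReIm Hrho fX.
have iu := bfs_itg Hrho fX.
set u := (fun x => normc (f (cis x))) in iu.
pose c := mean u; have c0 : 0 <= c by apply: mean_ge0 => x _; exact: normc_ge0.
have e9 : 0 < e / 9 by rewrite divr_gt0.
have [d3 d30 H3] := rnorm_absolutely_continuous Hrho Hsep Lg gfin e9.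
have [n n1 nlt] : exists2 n : R, 1 <= n & (1 + 2 * c) / (d3 * ep ^+ 2) < n.
  exists (Num.truncn ((1 + 2 * c) / (d3 * ep ^+ 2))).+1%:R; first by rewrite ler1n.
  exact: truncnS_gt.
have n0 : 0 < n by lra.
have e6 : 0 < e / (6 * n) by rewrite divr_gt0// mulr_gt0.
have [d2 d20 H2] := rnorm_absolutely_continuous Hrho Hsep Lg gfin e6.
have dl0 : 0 < d2 * ep / 2 by rewrite divr_gt0// mulr_gt0.
have [N _ /(_ N (leqnn N)) [/= N1 N2]] :=
  filterI (fejer_cvg_L1 i1 dl0) (fejer_cvg_L1 i2 dl0).
have [P PE] := fejer_mean_analytic N.+1 i1 i2 f0.
pose F := fejer_poly N.+1 u.
have FE x : Re F.[expi x] = fejer_mean N.+1 u x by exact: Re_fejer_poly.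
pose G := (n^-1)%:C *: F.
have GF z : Re G.[z] = n^-1 * Re F.[z].
  by rewrite hornerZ Re_mul /= mul0r subr0.
have F0 x : 0 <= fejer_mean N.+1 u x.
  by apply: fejer_mean_ge0 => y; exact: normc_ge0.
have Gc : Re G.[0] = c / n by rewrite GF Re_fejer_poly0// mulrC.
have [||||O [HO2 HO1]] := @exp_like_poly R G (1 / n).
- by rewrite divr_gt0.
- by move=> x; rewrite GF FE mulr_ge0// invr_ge0 ltW.
- by rewrite Gc divr_ge0// ltW.
- by rewrite hornerZ Im_mul Im_fejer_poly0 mul0r mulr0 addr0.
have LP : L0r (fun t => normc (f t - P.[\val t])).
  by apply: L0_normc; apply: L0B; [exact: fX.1|exact: L0_poly].
have LO : L0r (fun t : circle R => normc (O.[\val t] - 1)).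
  apply: L0_normc; apply: L0B; first exact: L0_poly.
  by split; exact: measurable_cst.
pose E1 := [set t | ep <= normc (f t - P.[\val t])].
pose E2 := [set t : circle R | ep <= normc (O.[\val t] - 1)].
have mE1 : measurable E1 by apply: measurable_superlevel; exact: LP.1.
have mE2 : measurable E2 by apply: measurable_superlevel; exact: LO.1.
have iP1 : itg (fun x => `|fejer_mean N.+1 (fun x => Re (f (cis x))) x - Re (f (cis x))|).
  exact/itg_abs/itgB/i1/itg_fejer_mean.
have iP2 : itg (fun x => `|fejer_mean N.+1 (fun x => Im (f (cis x))) x - Im (f (cis x))|).
  exact/itg_abs/itgB/i2/itg_fejer_mean.
have PfE x : `|normc (f (cis x) - P.[\val (cis x)])| <=
    `|fejer_mean N.+1 (fun x => Re (f (cis x))) x - Re (f (cis x))| +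
    `|fejer_mean N.+1 (fun x => Im (f (cis x))) x - Im (f (cis x))|.
  rewrite ger0_norm ?normc_ge0//; apply: le_trans (normc_le _) _.
  rewrite Re_add Im_add Re_opp Im_opp /= (PE x).1 (PE x).2.
  by rewrite distrC lerD2l distrC.
have iP : itg (fun x => normc (f (cis x) - P.[\val (cis x)])).
  apply: itg_le (itgD iP1 iP2) => [|x _]; last exact: PfE.
  exact: (measurable_comp_cis LP.1).
have m1 : (m E1 < d2%:E)%E.
  have := circle_chebyshev LP.1 iP ep0.
  rewrite (_ : [set t | _] = E1); last first.
    by apply/funext => t; rewrite /E1 /= ger0_norm// normc_ge0.
  move=> /le_lt_trans; apply; rewrite lte_fin ltr_pdivrMr//.
  apply: (@le_lt_trans _ _ (mean (fun x =>
    `|fejer_mean N.+1 (fun x => Re (f (cis x))) x - Re (f (cis x))| +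
    `|fejer_mean N.+1 (fun x => Im (f (cis x))) x - Im (f (cis x))|))).
    by apply: le_mean => [||x _]; [exact: itg_abs|exact: itgD|exact: PfE].
  by rewrite meanD// [ltRHS]splitr; apply: ltrD.
have LO2 : L0r (fun t : circle R => normc (O.[\val t] - 1) * normc (O.[\val t] - 1)).
  exact: L0rM.
have iO : itg (fun x => normc (O.[expi x] - 1) * normc (O.[expi x] - 1)).
  have OE x : O.[expi x] - 1 = (O - 1).[expi x] by rewrite hornerD hornerN hornerC.
  have [cr ci] := continuous_poly (O - 1).
  apply: (@eq_itg R (fun x => Re (O - 1).[expi x] * Re (O - 1).[expi x] +
      Im (O - 1).[expi x] * Im (O - 1).[expi x])).
    by move=> x _; rewrite -[RHS]expr2 sqr_normc_ReIm !OE !expr2.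
  by apply: itgD; apply: itgM_continuous => //; exact: continuous_itg.
have m2 : (m E2 < d3%:E)%E.
  have ep2 : 0 < ep * ep by rewrite mulr_gt0.
  have := circle_chebyshev LO2.1 iO ep2.
  rewrite (_ : [set t | _] = E2); last first.
    apply/funext => t; rewrite /E2 /= ger0_norm ?mulr_ge0 ?normc_ge0//.
    by rewrite -!expr2 ler_pXn2r// nnegrE ?normc_ge0// ltW.
  move=> /le_lt_trans; apply; rewrite lte_fin ltr_pdivrMr//.
  apply: (@le_lt_trans _ _ (1 / n + 2 * (c / n))).
    rewrite -Gc; apply: le_trans HO1; rewrite le_eqVlt; apply/orP; left; apply/eqP.
    by apply: eq_mean => x _; rewrite ger0_norm ?mulr_ge0 ?normc_ge0.
  rewrite (_ : 1 / n + 2 * (c / n) = (1 + 2 * c) / n); last by ring.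
  by rewrite ltr_pdivrMr// -expr2 [ltRHS]mulrC -ltr_pdivrMr// mulr_gt0// exprn_gt0.
have LA : L0r (fun t => 2 * ep * g t).
  by apply: L0rM => //; apply: L0r_cst; rewrite mulr_ge0// ltW.
have LB : L0r (fun t => 2 * n * cut E1 g t).
  by apply: L0rM; [apply: L0r_cst; rewrite mulr_ge0// ltW|exact: L0r_cut].
have LC : L0r (fun t => 3 * cut E2 g t).
  by apply: L0rM; [exact: L0r_cst|exact: L0r_cut].
exists (O * P).
apply: (@le_lt_trans _ _ (rnorm (fun t =>
    2 * ep * g t + 2 * n * cut E1 g t + 3 * cut E2 g t)%R)).
  apply: le_rnorm => //.
  - by apply: L0_normc; apply: L0B; [exact: fX.1|exact: L0_poly].
  - by apply: L0rD => //; exact: L0rD.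
  move=> t; have [x tx] := cis_surj t.
  have cutb (h : circle R -> R) : cut [set t | ep <= h t] g t =
      (1 + normc (f t)) * ((ep <= h t)%R)%:R.
    by rewrite /cut indicE; congr (_ * (nat_of_bool _)%:R); apply/idP/idP => [/set_mem|/mem_set].
  rewrite /E1 /E2 !cutb.
  have Pu : normc P.[\val t] <= n * Re G.[expi x].
    rewrite GF mulrA divff ?gt_eqF// mul1r FE tx.
    rewrite -(@ler_pXn2r _ 2)// ?nnegrE ?normc_ge0//.
    rewrite sqr_normc_ReIm (PE x).1 (PE x).2; apply: fejer_mean_complex_le => //.
      by move=> y; rewrite -sqr_normc_ReIm.
    by move=> y; exact: normc_ge0.
  have Ox : normc O.[\val t] ^+ 2 <= (1 + 1 / n) * expR (- (2 * Re G.[expi x])).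
    by rewrite tx; exact: HO2.
  rewrite hornerM; exact: (normc_split (f t) n1 (ltW ep0) Pu Ox).
have LAB := L0rD LA LB.
apply: le_lt_trans (rnormD Hrho LAB LC) _.
apply: le_lt_trans (leeD (rnormD Hrho LA LB) (lexx _)) _.
rewrite !rnormZ//; try exact: L0r_cut; last 2 first.
- by rewrite mulr_ge0// ltW.
- by rewrite mulr_ge0// ltW.
have [h1 [h10 h1E h1lt]] : exists h : R, [/\ 0 <= h, rnorm (cut E1 g) = h%:E & h < e / (6 * n)].
  have := H2 _ mE1 m1; have := rnorm_ge0 Hrho (L0r_cut mE1 Lg).
  by case: (rnorm _) => //= r; rewrite lee_fin lte_fin => ? ?; exists r.
have [h2 [h20 h2E h2lt]] : exists h : R, [/\ 0 <= h, rnorm (cut E2 g) = h%:E & h < e / 9].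
  have := H3 _ mE2 m2; have := rnorm_ge0 Hrho (L0r_cut mE2 Lg).
  by case: (rnorm _) => //= r; rewrite lee_fin lte_fin => ? ?; exists r.
rewrite GE h1E h2E -!EFinM -!EFinD lte_fin.
have : 2 * n * h1 < e / 3.
  rewrite (_ : e / 3 = 2 * n * (e / (6 * n))); last by field; rewrite gt_eqF.
  by rewrite ltr_pM2l// mulr_gt0.
lra.
Qed.

End density.

Theorem theorem1p5 (R : realType) (rho : (circle R -> \bar R) -> \bar R)
    (Hrho : banach_function_norm rho) (Hsep : bfs_separable rho) :
  bfs_dense rho analytic_polynomials (abstract_hardy rho).
Proof.
split; first exact: analytic_polynomials_hardy.
move=> f Hf e e0; have [p pe] := hardy_approx Hrho Hsep Hf e0.
by exists (fun t : circle R => p.[\val t]) => //; exists p.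
Qed.
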